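(* Let $\sigma\colon(\mathcal M,L)\to(\mathcal B,\tilde L)$ be a pseudo-Finsler submersion such that for every $v\in\mathcal A$ the vertical space at $\pi(v)$ is $g_v$-non-degenerate. For each admissible $v$, vertical $u,w$, $g_v$-horizontal $x$ and arbitrary $e,h$ at $p$, \begin{align*} ((\nabla_w\mathbf A)^v_eu)^\top_v&=(\mathbf T^v_w\mathbf A^v_e-\mathbf A^v_e\mathbf T^v_w)u, & ((\nabla_x\mathbf A)^v_eu)^\top_v&=(\mathbf A^v_x\mathbf A^v_e-\mathbf A^v_e\mathbf A^v_x)u,\\ ((\nabla_w\mathbf T)^v_eu)^\top_v&=(\mathbf T^v_w\mathbf T^v_e-\mathbf T^v_e\mathbf T^v_w)u, & ((\nabla_x\mathbf T)^v_eu)^\top_v&=(\mathbf A^v_x\mathbf T^v_e-\mathbf T^v_e\mathbf A^v_x)u, \end{align*} and for each $g_v$-horizontal $y$ at $p$, \begin{align*} ((\nabla_w\mathbf A)^v_ey)^\bot_v&=(\mathbf T^v_w\mathbf A^v_e-\mathbf A^v_e\mathbf T^v_w)y, & ((\nabla_x\mathbf A)^v_ey)^\bot_v&=(\mathbf A^v_x\mathbf A^v_e-\mathbf A^v_e\mathbf A^v_x)y,\\ ((\nabla_w\mathbf T)^v_ey)^\bot_v&=(\mathbf T^v_w\mathbf T^v_e-\mathbf T^v_e\mathbf T^v_w)y, & ((\nabla_x\mathbf T)^v_ey)^\bot_v&=(\mathbf A^v_x\mathbf T^v_e-\mathbf T^v_e\mathbf A^v_x)y. \end{align*} More synthetically,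 \begin{align*} ((\nabla_e(\mathbf T+\mathbf A))^v_hu)^\top_v&=(\mathbf T+\mathbf A)^v_e(\mathbf T+\mathbf A)^v_hu-(\mathbf T+\mathbf A)^v_h(\mathbf T+\mathbf A)^v_eu,\\ ((\nabla_e(\mathbf T+\mathbf A))^v_hy)^\bot_v&=(\mathbf T+\mathbf A)^v_e(\mathbf T+\mathbf A)^v_hy-(\mathbf T+\mathbf A)^v_h(\mathbf T+\mathbf A)^v_ey. \end{align*}
   Context: **Metrics.** A pseudo-Finsler metric on $\mathcal M$ (with projection $\pi\colon T\mathcal M\to\mathcal M$) is a smooth $L\colon\mathcal A\to\mathbb R$, $\mathcal A\subset T\mathcal M\setminus\mathbf 0$ open and invariant under positive scalar multiplication, with $L(\lambda v)=\lambda^2L(v)$ for $\lambda>0$ and with non-degenerate fundamental tensor $g_v(e,h)=\frac12\frac{\partial^2}{\partial s\partial t}L(v+se+th)|_{s=t=0}$. Elements of $\mathcal A$ are admissible. **Anisotropic calculus.** An anisotropic tensor $T$ assigns smoothly to $v\in\mathcal A$ a tensor $T_v$ (or $T^v$) on $T_{\pi(v)}\mathcal M$; an anisotropic vector field $\mathcal X$ assigns $\mathcal X_v\in T_{\pi(v)}\mathcal M$. $T_V$ is the ordinary tensor $(T_V)_q=T_{V_q}$ for an admissible local vector field $V$. Fiber derivative: $(\dot\partial T)_v(e)=\frac{d}{dt}T_{v+te}|_{t=0}$. An anisotropic connection assigns to vector fields $E,H$ an anisotropic vector field $\nabla_EH$, $v\mapsto\nabla^v_EH$, $C^\infty$-linear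 in $E$, additive and Leibniz in $H$. For anisotropic vector fields $\nabla^v_e\mathcal X=\nabla^v_e(\mathcal X_V)-(\dot\partial\mathcal X)_v(\nabla^v_eV)$, and for functions $f$ on $\mathcal A$, $(\nabla_ef)(v)=e(f(V))-(\dot\partial f)_v(\nabla^v_eV)$, for any admissible local extension $V$ of $v$ (independent of the choice); covariant derivatives of other anisotropic tensors are defined by the product rule. The Levi-Civita–Chern connection $\nabla$ of $(\mathcal M,L)$ is the unique anisotropic connection with $\nabla^v_EH-\nabla^v_HE=[E,H]_{\pi(v)}$ and $\nabla g=0$. **Submersions.** Let $\sigma\colon\mathcal M\to\mathcal B$ be a surjective map with surjective differential, $\mathcal V_p=\ker d\sigma_p$ (vertical vectors). An admissible $v\in T_p\mathcal M$ is horizontal if $g_v(v,w)=0$ for all $w\in\mathcal V_p$; a vector is $g_v$-horizontal if it is $g_v$-orthogonal to $\mathcal V_p$. $\sigma\colon(\mathcal M,L)\to(\mathcal B,\tilde L)$ is a pseudo-Finsler submersion if the restriction of $L$ to the tangent spaces of the fibers is a pseudo-Finsler metric on each fiber, and $L(v)=\tilde L(d\sigma(v))$ for every horizontal $v$. **O'Neill tensors.** For admissible $v\in T_p\mathcal M$, write $e=e^\top_v+e^\bot_v$ with $e^\top_v\in\mathcal V_p$ and $e^\bot_v$ $g_v$-horizontal; $E^\top,E^\bot$ are the anisotropic vector fields $v\mapsto(E_v)^\top_v$, $v\mapsto(E_v)^\bot_v$. Put $\chi^v_he=(\nabla^v_hE^\bot)^\top_v+(\nabla^v_hE^\top)^\bot_v$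 for any extension $E$ of $e$ (tensorial), and $\mathbf T^v_be=\chi^v_{b^\top_v}e$, $\mathbf A^v_be=\chi^v_{b^\bot_v}e$. *)

(* Defs.v *)
From HB Require Import structures.
From mathcomp Require Import all_boot all_order all_algebra.
From mathcomp Require Import all_classical all_reals all_analysis.
Set Implicit Arguments.
Unset Strict Implicit.
Unset Printing Implicit Defensive.
Import Order.TTheory GRing.Theory Num.Theory.
Import numFieldNormedType.Exports.
Local Open Scope classical_set_scope.
Local Open Scope ring_scope.

(* MathComp-Analysis world.  C^k and smooth maps between finite-dimensional
   normed spaces; only used for open U. *)

Fixpoint Ck_on (R : realType) (V W : normedModType R) (k : nat) (U : set V)
    (f : V -> W) : Prop :=
  if k is k'.+1 then
    (forall x, U x -> differentiable f x) /\ (forall v, Ck_on k' U ('D_v f))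
  else forall x, U x -> {for x, continuous f}.

Definition smooth_on (R : realType) (V W : normedModType R) (U : set V)
  (f : V -> W) : Prop := forall k, Ck_on k U f.

(* A smooth manifold: a Hausdorff second countable space with a (not
   necessarily maximal) smooth atlas.  A chart is a homeomorphism coord i from
   the open set dom i onto an open subset of R^dim, with inverse param i; both
   maps are total, with junk values elsewhere.  chart_at p is a preferred
   chart around p, used only to represent tangent vectors. *)

Record manifold (R : realType) := Manifold {
  dim : nat;
  point_of :> topologicalType;
  chart : Type;
  dom : chart -> set point_of;
  coord : chart -> point_of -> 'rV[R]_dim;
  param : chart -> 'rV[R]_dim -> point_of;
  chart_at : point_of -> chart;
  manifold_hausdorff : hausdorff_space point_of;
  manifold_second_countable : @second_countable point_of;
  dom_open : forall i, open (dom i);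
  dom_chart_at : forall p, dom (chart_at p) p;
  coord_dom_open : forall i, open (coord i @` dom i);
  coordK : forall i p, dom i p -> param i (coord i p) = p;
  coord_continuous : forall i p, dom i p -> {for p, continuous (coord i)};
  param_continuous : forall i x, (coord i @` dom i) x ->
    {for x, continuous (param i)};
  transition_smooth : forall i j,
    smooth_on (coord i @` (dom i `&` dom j)) (coord j \o param i)
}.

(* T_p M is R^dim, written 'T[R]_M, for every p: e in T_p M is the tangent vector whose
   components in the preferred chart of p are e.  The components of e in an
   arbitrary chart i around p are vcoord i p e, and vparam i p is the inverse
   of vcoord i p.  Because the trivialization changes with p, TM must not be
   given the product topology; all smoothness is expressed through charts. *)

Notation "''T[' R ]_ M" := 'rV[R]_(dim M)
  (at level 0, R at level 200, M at level 2, only parsing).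

Definition vcoord (R : realType) (M : manifold R) (i : chart M) (p : M)
    (e : 'T[R]_M) : 'rV[R]_(dim M) :=
  'D_e (coord i \o param (chart_at p)) (coord (chart_at p) p).

Definition vparam (R : realType) (M : manifold R) (i : chart M) (p : M)
    (y : 'rV[R]_(dim M)) : 'T[R]_M :=
  'D_y (coord (chart_at p) \o param i) (coord i p).

Definition smooth_fun (R : realType) (M : manifold R) (U : set M)
    (f : M -> R) : Prop :=
  forall i, smooth_on (V := 'rV[R]_(dim M)) (W := R^o)
    (coord i @` (U `&` dom i)) (f \o param i).

Definition smooth_map (R : realType) (M N : manifold R) (s : M -> N) : Prop :=
  continuous s /\
  forall (i : chart M) (j : chart N),
    smooth_on (coord i @` (dom i `&` s @^-1` dom j))
              (coord j \o s \o param i).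

Definition dmap (R : realType) (M N : manifold R) (s : M -> N) (p : M)
    (e : 'T[R]_M) : 'T[R]_N :=
  'D_e (coord (chart_at (s p)) \o s \o param (chart_at p))
       (coord (chart_at p) p).

Definition dfun (R : realType) (M : manifold R) (f : M -> R) (p : M)
    (e : 'T[R]_M) : R :=
  'D_e (f \o param (chart_at p) : 'rV[R]_(dim M) -> R^o)
       (coord (chart_at p) p).

Definition vfield (R : realType) (M : manifold R) := M -> 'T[R]_M.

Definition smooth_vfield (R : realType) (M : manifold R) (U : set M)
    (E : vfield M) : Prop :=
  forall i, smooth_on (coord i @` (U `&` dom i))
    (fun x => vcoord i (param i x) (E (param i x))).

Definition bracket (R : realType) (M : manifold R) (E H : vfield M) (p : M)
    : 'T[R]_M :=
  let c := chart_at p in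
  let rep (X : vfield M) x := vcoord c (param c x) (X (param c x)) in
  'D_(E p) (rep H) (coord c p) - 'D_(H p) (rep E) (coord c p).

(* The local vector field around p with value e at p and constant components
   in the preferred chart of p.  It serves as the extension of a tangent
   vector wherever an arbitrary one is allowed. *)
Definition ext (R : realType) (M : manifold R) (p : M) (e : 'T[R]_M)
  : vfield M := fun q => vparam (chart_at p) q e.

(* Subsets of TM, and objects depending on a direction v in T_p M.  These are
   total functions, whose values matter for admissible v only. *)

Definition tset (R : realType) (M : manifold R) := forall p : M, set ('T[R]_M).

Definition tchart (R : realType) (M : manifold R) (A : tset M) (i : chart M)
    : set ('rV[R]_(dim M) * 'rV[R]_(dim M))%type :=
  [set z | (coord i @` dom i) z.1 /\
           A (param i z.1) (vparam i (param i z.1) z.2)].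

Definition topen (R : realType) (M : manifold R) (A : tset M) : Prop :=
  forall i, open (tchart A i).

Definition afun (R : realType) (M : manifold R) := M -> 'T[R]_M -> R.

Definition smooth_afun (R : realType) (M : manifold R) (A : tset M)
    (f : afun M) : Prop :=
  forall i, smooth_on (V := ('rV[R]_(dim M) * 'rV[R]_(dim M))%type) (W := R^o)
    (tchart A i)
    (fun z => f (param i z.1) (vparam i (param i z.1) z.2)).

Definition avfield (R : realType) (M : manifold R) := M -> 'T[R]_M -> 'T[R]_M.

Definition smooth_avfield (R : realType) (M : manifold R) (A : tset M)
    (X : avfield M) : Prop :=
  forall i, smooth_on (V := ('rV[R]_(dim M) * 'rV[R]_(dim M))%type)
    (tchart A i)
    (fun z => vcoord i (param i z.1)
                (X (param i z.1) (vparam i (param i z.1) z.2))).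

(* anisotropic (1,2)-tensors: S p v b e stands for S^v_b e *)
Definition atensor (R : realType) (M : manifold R) :=
  M -> 'T[R]_M -> 'T[R]_M -> 'T[R]_M -> 'T[R]_M.

(* g_v(e,h) = 1/2 d^2/dsdt L(v + s e + t h) at s = t = 0 *)
Definition fundamental (R : realType) (M : manifold R) (L : afun M) (p : M)
    (v e h : 'T[R]_M) : R :=
  2^-1 * 'D_e ('D_h (L p : 'T[R]_M -> R^o)) v.

Record pseudo_finsler (R : realType) (M : manifold R) (A : tset M)
    (L : afun M) : Prop := PseudoFinsler {
  admissible_neq0 : forall p v, A p v -> v != 0;
  admissible_open : topen A;
  admissible_conic : forall p v (l : R), 0 < l -> A p v -> A p (l *: v);
  metric_smooth : smooth_afun A L;
  metric_homogeneous : forall p v (l : R), 0 < l -> A p v ->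
    L p (l *: v) = l ^+ 2 * L p v;
  metric_nondegenerate : forall p v e, A p v ->
    (forall h, fundamental L p v e h = 0) -> e = 0
}.

(* An anisotropic connection, as an operator on local vector fields: a local
   field on an open set U is a total one that is smooth on U, and the value of
   nabla E H over U only depends on E and H on U. *)

Definition connection (R : realType) (M : manifold R) :=
  vfield M -> vfield M -> avfield M.

Record anisotropic_connection (R : realType) (M : manifold R) (A : tset M)
    (nabla : connection M) : Prop := AnisotropicConnection {
  nabla_local : forall (U : set M) (E E' H H' : vfield M), open U ->
    smooth_vfield U E -> smooth_vfield U H ->
    (forall q, U q -> E q = E' q) -> (forall q, U q -> H q = H' q) ->
    forall p v, U p -> A p v -> nabla E H p v = nabla E' H' p v;
  nabla_smooth : forall (U : set M) (E H : vfield M), open U ->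
    smooth_vfield U E -> smooth_vfield U H ->
    smooth_avfield (fun p v => U p /\ A p v) (nabla E H);
  nabla_additivel : forall (U : set M) (E E' H : vfield M), open U ->
    smooth_vfield U E -> smooth_vfield U E' -> smooth_vfield U H ->
    forall p v, U p -> A p v ->
    nabla (fun q => E q + E' q) H p v = nabla E H p v + nabla E' H p v;
  nabla_scalel : forall (U : set M) (f : M -> R) (E H : vfield M), open U ->
    smooth_fun U f -> smooth_vfield U E -> smooth_vfield U H ->
    forall p v, U p -> A p v ->
    nabla (fun q => f q *: E q) H p v = f p *: nabla E H p v;
  nabla_additiver : forall (U : set M) (E H H' : vfield M), open U ->
    smooth_vfield U E -> smooth_vfield U H -> smooth_vfield U H' ->
    forall p v, U p -> A p v ->
    nabla E (fun q => H q + H' q) p v = nabla E H p v + nabla E H' p v;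
  nabla_leibniz : forall (U : set M) (f : M -> R) (E H : vfield M), open U ->
    smooth_fun U f -> smooth_vfield U E -> smooth_vfield U H ->
    forall p v, U p -> A p v ->
    nabla E (fun q => f q *: H q) p v
      = dfun f p (E p) *: H p + f p *: nabla E H p v
}.

(* nabla^v_e H for a vector e and a field H *)
Definition nabla_at (R : realType) (M : manifold R) (nabla : connection M)
    (H : vfield M) (p : M) (v e : 'T[R]_M) : 'T[R]_M :=
  nabla (ext p e) H p v.

(* Covariant derivatives of anisotropic objects.  The formulas do not depend
   on the admissible local extension V of v, nor, for tensors, on the local
   extensions of the arguments; they are taken to be given by ext. *)

(* (nabla_e f)(v) = e(f(V)) - (fiber derivative of f)_v (nabla^v_e V) *)
Definition cov_fun (R : realType) (M : manifold R) (nabla : connection M)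
    (f : afun M) (p : M) (v e : 'T[R]_M) : R :=
  let V := ext p v in
  dfun (fun q => f q (V q)) p e
    - 'D_(nabla_at nabla V p v e) (f p : 'T[R]_M -> R^o) v.

(* nabla^v_e X = nabla^v_e (X_V) - (fiber derivative of X)_v (nabla^v_e V) *)
Definition cov_field (R : realType) (M : manifold R) (nabla : connection M)
    (X : avfield M) (p : M) (v e : 'T[R]_M) : 'T[R]_M :=
  let V := ext p v in
  nabla_at nabla (fun q => X q (V q)) p v e
    - 'D_(nabla_at nabla V p v e) (X p) v.

(* (nabla_z S)^v_b e, by the product rule *)
Definition cov_tensor (R : realType) (M : manifold R) (nabla : connection M)
    (S : atensor M) (p : M) (v z b e : 'T[R]_M) : 'T[R]_M :=
  let B := ext p b in
  let E := ext p e in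
  cov_field nabla (fun q y => S q y (B q) (E q)) p v z
    - S p v (nabla_at nabla B p v z) e
    - S p v b (nabla_at nabla E p v z).

(* (nabla_z g)_v(b,e), by the product rule *)
Definition cov_metric (R : realType) (M : manifold R) (nabla : connection M)
    (L : afun M) (p : M) (v z b e : 'T[R]_M) : R :=
  let g := fundamental L in
  let B := ext p b in
  let E := ext p e in
  cov_fun nabla (fun q y => g q y (B q) (E q)) p v z
    - g p v (nabla_at nabla B p v z) e
    - g p v b (nabla_at nabla E p v z).

Record levi_civita_chern (R : realType) (M : manifold R) (A : tset M)
    (L : afun M) (nabla : connection M) : Prop := LeviCivitaChern {
  lcc_connection : anisotropic_connection A nabla;
  lcc_torsion_free : forall (U : set M) (E H : vfield M), open U ->
    smooth_vfield U E -> smooth_vfield U H ->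
    forall p v, U p -> A p v ->
    nabla E H p v - nabla H E p v = bracket E H p;
  lcc_metric : forall p v z b e, A p v -> cov_metric nabla L p v z b e = 0
}.

Definition vertical (R : realType) (M B : manifold R) (s : M -> B) (p : M)
    (w : 'T[R]_M) : Prop := dmap s p w = 0.

(* e is g_v-horizontal; an admissible v is horizontal when it is
   g_v-horizontal *)
Definition ghorizontal (R : realType) (M B : manifold R) (s : M -> B)
    (L : afun M) (p : M) (v e : 'T[R]_M) : Prop :=
  forall w, vertical s p w -> fundamental L p v e w = 0.

(* i presents the manifold F as the fiber of s over b: it is an embedding
   with image s^-1(b) *)
Definition fiber_embedding (R : realType) (M B F : manifold R) (s : M -> B)
    (b : B) (i : F -> M) : Prop :=
  [/\ smooth_map i,
      forall q, injective (@dmap R F M i q),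
      injective i,
      range i = s @^-1` [set b] &
      forall U : set F, open U ->
        exists2 W : set M, open W & U = i @^-1` W].

Record pseudo_finsler_submersion (R : realType) (M B : manifold R)
    (s : M -> B) (A : tset M) (L : afun M) (A' : tset B) (L' : afun B)
    : Prop := PseudoFinslerSubmersion {
  submersion_smooth : smooth_map s;
  submersion_surjective : forall b, exists p, s p = b;
  submersion_dsurjective : forall p f, exists e, dmap s p e = f;
  submersion_fibers : forall (F : manifold R) (b : B) (i : F -> M),
    fiber_embedding s b i ->
    pseudo_finsler (fun q => [set e | A (i q) (dmap i q e)])
                   (fun q e => L (i q) (dmap i q e));
  submersion_metric : forall p v, A p v -> ghorizontal s L p v v ->
    A' (s p) (dmap s p v) /\ L p v = L' (s p) (dmap s p v)
}.

Definition vertical_nondegenerate (R : realType) (M B : manifold R)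
    (s : M -> B) (A : tset M) (L : afun M) : Prop :=
  forall p v, A p v -> forall w, vertical s p w ->
    (forall w', vertical s p w' -> fundamental L p v w w' = 0) -> w = 0.

(* e = vpart e + hpart e with vpart e vertical and hpart e g_v-horizontal.
   The decomposition exists and is unique as soon as the vertical space is
   g_v-non-degenerate; 0 is a junk value. *)
Definition vpart (R : realType) (M B : manifold R) (s : M -> B) (L : afun M)
    (p : M) (v e : 'T[R]_M) : 'T[R]_M :=
  xget 0 [set t | vertical s p t /\ ghorizontal s L p v (e - t)].

Definition hpart (R : realType) (M B : manifold R) (s : M -> B) (L : afun M)
    (p : M) (v e : 'T[R]_M) : 'T[R]_M := e - vpart s L p v e.

(* chi^v_h e *)
Definition oneill_chi (R : realType) (M B : manifold R) (s : M -> B)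
    (L : afun M) (nabla : connection M) : atensor M := fun p v h e =>
  let E := ext p e in
  vpart s L p v (cov_field nabla (fun q y => hpart s L q y (E q)) p v h)
  + hpart s L p v (cov_field nabla (fun q y => vpart s L q y (E q)) p v h).

Definition oneill_T (R : realType) (M B : manifold R) (s : M -> B)
    (L : afun M) (nabla : connection M) : atensor M := fun p v b e =>
  oneill_chi s L nabla p v (vpart s L p v b) e.

Definition oneill_A (R : realType) (M B : manifold R) (s : M -> B)
    (L : afun M) (nabla : connection M) : atensor M := fun p v b e =>
  oneill_chi s L nabla p v (hpart s L p v b) e.

Definition oneill_TA (R : realType) (M B : manifold R) (s : M -> B)
    (L : afun M) (nabla : connection M) : atensor M := fun p v b e =>
  oneill_T s L nabla p v b e + oneill_A s L nabla p v b e.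

(* Main.v *)
(* In row-vector coordinates the vertical projection is a smooth family P of
   idempotent matrices on a chart of the admissible set; it is obtained by
   solving the linear system characterising g_v-orthogonal projection on
   ker d(sigma).  Write N_h for the anisotropic covariant derivative along h and
   chi_h = P (N_h Q) + Q (N_h P) with Q = 1 - P, a combination of N_h P and P
   only.  Differentiating P P = P shows that chi_h exchanges vertical and
   horizontal vectors, so that S = P S + S P for each of S = T_e, A_e, (T + A)_e.
   Differentiating this last relation, and rewriting N_h P in terms of chi_h, gives
   all the formulas at once, since chi_w = T_w for w vertical and chi_x = A_x for
   x horizontal. *)
Require Import Defs.
From HB Require Import structures.
From mathcomp Require Import all_boot all_order all_algebra.
From mathcomp Require Import all_classical all_reals all_analysis.
From mathcomp Require Import ring.
Import Defs.
Set Implicit Arguments.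
Unset Strict Implicit.
Unset Printing Implicit Defensive.
Import Order.TTheory GRing.Theory Num.Theory.
Import numFieldNormedType.Exports.
Local Open Scope classical_set_scope.
Local Open Scope ring_scope.

(** The commutators come from a sign. As operators, chi_h = (1 - 2P) N_h P, so chi_h agrees with N_h
    P on vertical vectors and with its opposite on horizontal ones. Compressing the derivative of S
    = P S + S P to the vertical block gives P (N_h S) P = - P (N_h P) S P - P S (N_h P) P. In the
    first term N_h P acts on a horizontal vector, in the second on a vertical one, so the right-hand
    side is P (chi_h S - S chi_h) P. Matrices act on rows, hence the operator product chi S appears
    as the matrix product S chi.

    The obstacle is the representation: tangent vectors are written in a preferred chart that may
    jump from point to point, and [vpart] is a pointwise choice. Everything is therefore transported
    to fixed charts [c] around p and [d] around s p, where the projection becomes a rational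
    expression in the metric and the differential of s. *)

Lemma near_eq_differentiable (R : realType) (V W : normedModType R)
    (f g : V -> W) (x : V) :
  (\near x, f x = g x) -> differentiable f x -> differentiable g x.
Proof.
move=> fg df.
(* [g - f] vanishes near x, so the zero map satisfies the expansion that characterises its
   differential; then [g] is [f] plus a map differentiable at x. *)
have [c0 d0] : continuous (\0 : V -> W) /\
    (g - f) \o shift x = cst ((g - f) x) + (\0 : V -> W) +o_ 0 id.
  split; first exact: cst_continuous.
  apply/eqaddoP => e e0.
  have fg0 := fg; rewrite (near_shift 0) /= subr0 in fg0.
  near=> h; have fgh : f (h + x) = g (h + x) by near: h.
  by rewrite !fctE /= fgh (nbhs_singleton fg) !subrr addr0 subrr normr0
    mulr_ge0 // ltW.
have -> : g = f + (g - f) by rewrite addrC subrK.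
apply: differentiableD => //; apply/diff_locallyP.
by rewrite (diff_unique c0 d0).
Unshelve. all: by end_near. Qed.

(** * Calculus of C^k and smooth maps between normed spaces *)

Section Ck.
Variable R : realType.
Implicit Types V W : normedModType R.

(** Maps are total, with junk off [U]. Openness turns equality on [U] into equality of germs, which
    passes to directional derivatives and lets the induction on [k] continue. *)
Lemma Ck_on_eq V W k (U : set V) (f g : V -> W) : open U ->
  (forall x, U x -> f x = g x) -> Ck_on k U f -> Ck_on k U g.
Proof.
move=> oU; elim: k f g => [|k IH] f g fg /=.
  move=> cf x Ux; have fgx : \near x, f x = g x.
    by near=> y; apply: fg; near: y; exact: open_nbhs_nbhs.
  have := cf x Ux; rewrite /prop_for /continuous_at -(fg x Ux) => /=.
  apply: cvg_trans; apply: near_eq_cvg; exact: fgx.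
have fgn x : U x -> \near x, f x = g x.
  by move=> Ux; near=> y; apply: fg; near: y; exact: open_nbhs_nbhs.
case=> df Df; split=> [x Ux|v].
  exact: near_eq_differentiable (fgn x Ux) (df x Ux).
by apply: IH (Df v) => x Ux; exact/near_eq_derive/fgn.
Unshelve. all: by end_near. Qed.

Lemma Ck_on_sub V W k (U U' : set V) (f : V -> W) : U `<=` U' ->
  Ck_on k U' f -> Ck_on k U f.
Proof.
move=> sU; elim: k f => [|k IH] f /=; first by move=> h x /sU /h.
by case=> df Df; split=> [x /sU /df//|v]; exact: IH.
Qed.

Lemma Ck_onW V W k (U : set V) (f : V -> W) : Ck_on k.+1 U f -> Ck_on k U f.
Proof.
elim: k f => [|k IH] f.
  by case=> df _ x Ux; exact/differentiable_continuous/df.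
by case=> df Df; split=> // v; exact/IH/Df.
Qed.

Lemma derive_linear V W W' (l : {linear W -> W'}) (f : V -> W) x v :
  continuous l -> derivable f x v -> 'D_v (l \o f) x = l ('D_v f x).
Proof.
move=> cl df; apply: cvg_lim => //.
under eq_fun => h do rewrite /= -linearB -linearZ.
apply: continuous_cvg => //; exact: cl.
Qed.

Lemma Ck_on_linear V W W' (l : {linear W -> W'}) k (U : set V) (f : V -> W) :
  open U -> continuous l -> Ck_on k U f -> Ck_on k U (l \o f).
Proof.
move=> oU cl; elim: k f => [|k IH] f /=.
  by move=> cf x Ux; apply: continuous_comp; [exact: cf|exact: cl].
case=> df Df; split=> [x Ux|v].
  apply: differentiable_comp; first exact: df.
  exact: linear_differentiable.
apply: Ck_on_eq (IH _ (Df v)) => // x Ux.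
by rewrite derive_linear//; exact/diff_derivable/df.
Qed.

Lemma Ck_on_cst V W k (U : set V) (a : W) : Ck_on k U (cst a).
Proof.
elim: k a => [|k IH] a /=; first by move=> x _; exact: cst_continuous.
split=> [x _|v]; first exact: differentiable_cst.
rewrite (_ : 'D_v _ = cst 0); first exact: IH.
by apply/funext => x; rewrite derive_cst.
Qed.

Lemma Ck_onD V W k (U : set V) (f g : V -> W) : open U ->
  Ck_on k U f -> Ck_on k U g -> Ck_on k U (f + g).
Proof.
move=> oU; elim: k f g => [|k IH] f g /=.
  by move=> cf cg x Ux; apply: continuousD; [exact: cf|exact: cg].
move=> [df Df] [dg Dg]; split=> [x Ux|v].
  by apply: differentiableD; [exact: df|exact: dg].
apply: Ck_on_eq (IH _ _ (Df v) (Dg v)) => // x Ux.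
by rewrite deriveD//; apply: diff_derivable; [exact: df|exact: dg].
Qed.

Lemma differentiable_bilinear V (W1 W2 W : normedModType R)
    (b : {bilinear W1 -> W2 -> W}) (f : V -> W1) (g : V -> W2) x :
  continuous (fun p => b p.1 p.2) ->
  differentiable f x -> differentiable g x ->
  differentiable (fun x => b (f x) (g x)) x.
Proof.
move=> cb df dg.
have dp := differentiable_pair df dg.
exact: (differentiable_comp dp (differentiable_bilin _ cb)).
Qed.

Lemma derive_bilinear V (W1 W2 W : normedModType R)
    (b : {bilinear W1 -> W2 -> W}) (f : V -> W1) (g : V -> W2) x v :
  continuous (fun p => b p.1 p.2) ->
  differentiable f x -> differentiable g x ->
  'D_v (fun x => b (f x) (g x)) x = b ('D_v f x) (g x) + b (f x) ('D_v g x).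
Proof.
move=> cb df dg; rewrite !deriveE //; last exact: differentiable_bilinear.
have dp := differentiable_pair df dg.
have -> : (fun x => b (f x) (g x)) =
  (fun p => b p.1 p.2) \o (fun x => (f x, g x)) by [].
rewrite diff_comp //; last exact: differentiable_bilin.
by rewrite /= diff_bilin//= diff_pair //= addrC.
Qed.

(** By Leibniz the derivative is a sum of two terms of the same shape, with one factor
    differentiated and the other lowered to order k by [Ck_onW]; products of scalars and scalings
    are instances. *)
Lemma Ck_on_bilinear V (W1 W2 W : normedModType R)
    (b : {bilinear W1 -> W2 -> W}) k (U : set V) (f : V -> W1) (g : V -> W2) :
  open U -> continuous (fun p => b p.1 p.2) ->
  Ck_on k U f -> Ck_on k U g -> Ck_on k U (fun x => b (f x) (g x)).
Proof.
move=> oU cb; elim: k f g => [|k IH] f g.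
  move=> /= cf cg x Ux.
  apply: (@continuous_comp _ _ _ (fun x => (f x, g x)) (fun p => b p.1 p.2)).
    by apply: cvg_pair; [exact: cf|exact: cg].
  exact: cb.
move=> Cf Cg; have [df Df] := Cf; have [dg Dg] := Cg; split=> [x Ux|v].
  by apply: differentiable_bilinear => //; [exact: df|exact: dg].
have /Ck_onD := IH _ _ (Df v) (Ck_onW Cg).
move=> /(_ _ oU (IH _ _ (Ck_onW Cf) (Dg v))).
apply: Ck_on_eq => // x Ux.
by rewrite derive_bilinear//; [exact: df|exact: dg].
Qed.

Lemma Ck_onM V k (U : set V) (f g : V -> R^o) : open U ->
  Ck_on k U f -> Ck_on k U g -> Ck_on k U (fun x => f x * g x : R^o).
Proof.
by move=> oU; apply: (Ck_on_bilinear (b := @GRing.mul R)) => // p;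
  exact: mul_continuous.
Qed.

Lemma scale_is_bilinear V : bilinear_for
  (GRing.Scale.Law.clone _ _ *:%R _) (GRing.Scale.Law.clone _ _ *:%R _)
  (fun (a : R^o) (v : V) => a *: v).
Proof.
split=> [v|a] c x y /=; first by rewrite scalerDl scalerA.
by rewrite scalerDr !scalerA mulrC.
Qed.

Lemma Ck_onZ V W k (U : set V) (f : V -> R^o) (g : V -> W) : open U ->
  Ck_on k U f -> Ck_on k U g -> Ck_on k U (fun x => f x *: g x).
Proof.
pose bM := bilinear_isBilinear.Build R R^o W W _ _ _ (@scale_is_bilinear W).
pose b : {bilinear R^o -> W -> W} := HB.pack (fun (a : R^o) (v : W) => a *: v) bM.
move=> oU; apply: (Ck_on_bilinear (b := b)) => // p.
exact: scale_continuous.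
Qed.

Lemma Ck_onV V k (U : set V) (f : V -> R^o) : open U ->
  (forall x, U x -> f x != 0) -> Ck_on k U f ->
  Ck_on k U (fun x => (f x)^-1 : R^o).
Proof.
move=> oU f0; elim: k => [|k IH].
  by move=> /= cf x Ux; apply: cvgV; [exact: f0|exact: cf].
move=> Cf; have [df Df] := Cf; split=> [x Ux|v].
  by apply: (@differentiableV R V f); [exact: df|exact: f0].
have IHf := IH (Ck_onW Cf).
(* The derivative of 1/f is minus the square of 1/f times the derivative of f; the only inverse in
   it is 1/f, of class C^k by induction. *)
have := Ck_onM oU (Ck_onM oU (@Ck_on_cst V R^o k U (-1)) (Ck_onM oU IHf IHf))
  (Df v).
apply: Ck_on_eq => // x Ux; rewrite [RHS]deriveE; last first.
  by apply: (@differentiableV R V f); [exact: df|exact: f0].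
rewrite (@diffV R V f); [|exact: df|exact: f0].
by rewrite /= deriveE; [rewrite /cst /= mulN1r -invfM -expr2 scaleNr mulNr|exact: df].
Qed.

Lemma linear_pack V W (l : V -> W) : linear l ->
  exists l' : {linear V -> W}, l = l'.
Proof.
move=> ll; pose lM := GRing.isLinear.Build _ _ _ _ _ ll.
pose l' : {linear V -> W} := HB.pack l lM; by exists l'.
Qed.

(** Finite dimension in the form that the chain rule uses: every vector is recovered from continuous
    linear coordinates. *)
Definition has_frame V := exists n (b : 'I_n -> V) (l : 'I_n -> {linear V -> R^o}),
  (forall i, continuous (l i)) /\ forall x, x = \sum_i l i x *: b i.

Lemma has_frame_rV n : has_frame 'rV[R]_n.
Proof.
have /choice[l hl] (i : 'I_n) : exists l' : {linear 'rV[R]_n -> R^o},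
    (fun x : 'rV[R]_n => x 0 i : R^o) = l'.
  by apply: linear_pack => a x y; rewrite !mxE.
exists n, (delta_mx 0), l; split=> [i|x]; last first.
  by rewrite [LHS]row_sum_delta; apply: eq_bigr => i _; rewrite -hl.
by rewrite -hl; exact: matrix_normedtype.coord_continuous.
Qed.

Lemma has_frame_prod V W : has_frame V -> has_frame W ->
  has_frame (V * W)%type.
Proof.
move=> [n [b [l [cl lb]]]] [m [c [k [ck kc]]]].
have /choice[l' hl'] (i : 'I_n + 'I_m) :
    exists l' : {linear (V * W)%type -> R^o},
    (fun p : V * W => match i with inl i => l i p.1 | inr i => k i p.2 end) = l'.
  by apply: linear_pack => a x y; case: i => i; rewrite linearP.
exists (n + m)%N, (fun i => match fintype.split i with inl i => (b i, 0)
  | inr i => (0, c i) end), (l' \o @fintype.split n m).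
split=> [i|[x y]].
  rewrite /= -hl'; case: (fintype.split i) => j p.
    by apply: continuous_comp; [exact: cvg_fst|exact: cl].
  by apply: continuous_comp; [exact: cvg_snd|exact: ck].
rewrite big_split_ord /=.
under eq_bigr => i _ do rewrite (unsplitK (inl i)) -hl' /=.
under [X in _ + X]eq_bigr => i _ do rewrite (unsplitK (inr i)) -hl' /=.
have Sl (s : seq 'I_n) : \sum_(i <- s) l i x *: (b i, 0 : W) =
    (\sum_(i <- s) l i x *: b i, 0).
  elim: s => [|i s IH]; first by rewrite !big_nil.
  by rewrite !big_cons IH; congr pair => /=; rewrite scaler0 addr0.
have Sr (s : seq 'I_m) : \sum_(i <- s) k i y *: (0 : V, c i) =
    (0, \sum_(i <- s) k i y *: c i).
  elim: s => [|i s IH]; first by rewrite !big_nil.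
  by rewrite !big_cons IH; congr pair => /=; rewrite scaler0 addr0.
by rewrite Sl Sr -lb -kc; congr pair; rewrite /= ?addr0 ?add0r.
Qed.

Lemma Ck_on_sum V W (I : Type) (r : seq I) (P : pred I) (F : I -> V -> W) k
  (U : set V) : open U -> (forall i, Ck_on k U (F i)) ->
  Ck_on k U (fun x => \sum_(i <- r | P i) F i x).
Proof.
move=> oU CF; elim: r => [|i r IH].
  under eq_fun do rewrite big_nil; exact: Ck_on_cst.
under eq_fun do rewrite big_cons.
by case: (P i) => //; apply: (Ck_onD oU) => //; exact: CF.
Qed.

Lemma derive_comp V V' W (f : V -> W) (g : V' -> V) x v :
  differentiable g x -> differentiable f (g x) ->
  'D_v (f \o g) x = 'D_('D_v g x) f (g x).
Proof.
move=> dg df; rewrite !deriveE //; last exact: differentiable_comp.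
by rewrite diff_comp.
Qed.

Lemma derive_dirD V W (f : V -> W) x u v : differentiable f x ->
  'D_(u + v) f x = 'D_u f x + 'D_v f x.
Proof. by move=> df; rewrite !deriveE// linearD. Qed.

Lemma derive_dirZ V W (f : V -> W) x a v : differentiable f x ->
  'D_(a *: v) f x = a *: 'D_v f x.
Proof. by move=> df; rewrite !deriveE// linearZ. Qed.

Lemma derive_dir_sum V W (I : Type) (r : seq I) (f : V -> W) x (a : I -> V) :
  differentiable f x ->
  'D_(\sum_(i <- r) a i) f x = \sum_(i <- r) 'D_(a i) f x.
Proof.
by move=> df; rewrite deriveE// linear_sum; apply: eq_bigr => i _; rewrite deriveE.
Qed.

(** [Ck_on] speaks of derivatives along fixed directions only, while the chain rule differentiates
    [f] along the moving direction ['D_v g x]. Expanding that direction in a frame moves its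
    dependence on x into scalar coefficients. *)
Lemma Ck_on_comp V V' W k (U : set V') (U' : set V) (f : V -> W) (g : V' -> V) :
  has_frame V -> open U -> open U' -> (forall x, U x -> U' (g x)) ->
  Ck_on k U' f -> Ck_on k U g -> Ck_on k U (f \o g).
Proof.
move=> [n [b [l [cl lb]]]] oU oU' gU; elim: k f g gU => [|k IH] f g gU.
  by move=> /= cf cg x Ux; apply: continuous_comp; [exact: cg|exact/cf/gU].
move=> Cf Cg; have [df Df] := Cf; have [dg Dg] := Cg; split=> [x Ux|v].
  by apply: differentiable_comp; [exact: dg|exact/df/gU].
have : Ck_on k U (fun x => \sum_i l i ('D_v g x) *: 'D_(b i) f (g x)).
  apply: Ck_on_sum => // i; apply: Ck_onZ => //.
    exact (Ck_on_linear (l := l i) oU (cl i) (Dg v)).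
  exact: IH gU (Df (b i)) (Ck_onW Cg).
apply: Ck_on_eq => // x Ux; rewrite derive_comp; [|exact: dg|exact/df/gU].
rewrite [in RHS](lb ('D_v g x)) derive_dir_sum; last exact/df/gU.
by apply: eq_bigr => i _; rewrite derive_dirZ//; exact/df/gU.
Qed.

Lemma Ck_on_mxP V k (U : set V) m n (F : V -> 'M[R]_(m, n)) : open U ->
  Ck_on k U F <-> forall i j, Ck_on k U (fun x => F x i j : R^o).
Proof.
move=> oU; split=> [CF i j|CF].
  have [l hl] : exists l' : {linear 'M[R]_(m, n) -> R^o},
      (fun A : 'M[R]_(m, n) => A i j : R^o) = l'.
    by apply: linear_pack => a x y; rewrite !mxE.
  rewrite (_ : (fun _ => _) = l \o F); last by rewrite -hl.
  by apply: Ck_on_linear => //; rewrite -hl; exact: matrix_normedtype.coord_continuous.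
have -> : F = fun x => \sum_i \sum_j F x i j *: delta_mx i j.
  by apply/funext => x; exact: matrix_sum_delta.
by do 2!(apply: Ck_on_sum => // ?); apply: Ck_onZ => //; exact: Ck_on_cst.
Qed.

Lemma smooth_on_eq V W (U : set V) (f g : V -> W) : open U ->
  (forall x, U x -> f x = g x) -> smooth_on U f -> smooth_on U g.
Proof. by move=> oU fg sf k; exact: Ck_on_eq (sf k). Qed.

Lemma smooth_on_sub V W (U U' : set V) (f : V -> W) : U `<=` U' ->
  smooth_on U' f -> smooth_on U f.
Proof. by move=> sU sf k; exact: Ck_on_sub (sf k). Qed.

Lemma smooth_differentiable V W (U : set V) (f : V -> W) x :
  smooth_on U f -> U x -> differentiable f x.
Proof. by move=> /(_ 1%N)[df _] /df. Qed.

Lemma smooth_derive V W (U : set V) (f : V -> W) v :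
  smooth_on U f -> smooth_on U ('D_v f).
Proof. by move=> sf k; have [_] := sf k.+1; exact. Qed.

Lemma smooth_linear V W W' (l : W -> W') (U : set V) (f : V -> W) :
  open U -> linear l -> continuous l -> smooth_on U f -> smooth_on U (l \o f).
Proof.
by move=> oU /linear_pack[l' ->] cl sf k; exact: Ck_on_linear.
Qed.

Lemma smooth_cst V W (U : set V) (a : W) : smooth_on U (cst a).
Proof. by move=> k; exact: Ck_on_cst. Qed.

Lemma smooth_id V (U : set V) : smooth_on U (@id V).
Proof.
case=> [|k] /=; first by move=> x _; exact: cvg_id.
split=> [x _|v]; first exact: (@ex_diff _ _ _ _ _ id id).
rewrite (_ : 'D_v id = cst v); first exact: Ck_on_cst.
by apply/funext => x; rewrite derive_id.
Qed.

Lemma smoothD V W (U : set V) (f g : V -> W) : open U ->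
  smooth_on U f -> smooth_on U g -> smooth_on U (fun x => f x + g x).
Proof. by move=> oU sf sg k; exact: Ck_onD. Qed.

Lemma smooth_sum V W (I : Type) (r : seq I) (P : pred I) (F : I -> V -> W)
  (U : set V) : open U -> (forall i, smooth_on U (F i)) ->
  smooth_on U (fun x => \sum_(i <- r | P i) F i x).
Proof. by move=> oU sF k; apply: Ck_on_sum => // i; exact: sF. Qed.

Lemma smoothZ V W (U : set V) (f : V -> R^o) (g : V -> W) : open U ->
  smooth_on U f -> smooth_on U g -> smooth_on U (fun x => f x *: g x).
Proof. by move=> oU sf sg k; exact: Ck_onZ. Qed.

Lemma smoothM V (U : set V) (f g : V -> R^o) : open U ->
  smooth_on U f -> smooth_on U g -> smooth_on U (fun x => f x * g x : R^o).
Proof. by move=> oU sf sg k; exact: Ck_onM. Qed.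

Lemma smoothN V W (U : set V) (f : V -> W) : open U ->
  smooth_on U f -> smooth_on U (fun x => - f x).
Proof.
move=> oU sf; under eq_fun do rewrite -scaleN1r.
by apply: smoothZ => //; exact: smooth_cst.
Qed.

Lemma smoothB V W (U : set V) (f g : V -> W) : open U ->
  smooth_on U f -> smooth_on U g -> smooth_on U (fun x => f x - g x).
Proof. by move=> oU sf sg; apply: smoothD => //; exact: smoothN. Qed.

Lemma smoothV V (U : set V) (f : V -> R^o) : open U ->
  (forall x, U x -> f x != 0) -> smooth_on U f ->
  smooth_on U (fun x => (f x)^-1 : R^o).
Proof. by move=> oU f0 sf k; exact: Ck_onV. Qed.

Lemma smooth_prod V (I : Type) (r : seq I) (F : I -> V -> R^o)
  (U : set V) : open U -> (forall i, smooth_on U (F i)) ->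
  smooth_on U (fun x => \prod_(i <- r) F i x : R^o).
Proof.
move=> oU sF; elim: r => [|i r IH].
  under eq_fun do rewrite big_nil; exact: smooth_cst.
by under eq_fun do rewrite big_cons; exact: smoothM.
Qed.

Lemma smooth_comp V V' W (U : set V') (U' : set V) (f : V -> W) (g : V' -> V) :
  has_frame V -> open U -> open U' -> (forall x, U x -> U' (g x)) ->
  smooth_on U' f -> smooth_on U g -> smooth_on U (f \o g).
Proof. by move=> fV oU oU' gU sf sg k; exact: Ck_on_comp gU _ _. Qed.

Lemma smooth_pair V W W' (U : set V) (f : V -> W) (g : V -> W') : open U ->
  smooth_on U f -> smooth_on U g -> smooth_on U (fun x => (f x, g x)).
Proof.
move=> oU sf sg.
have sl : smooth_on U ((fun w => (w, 0 : W')) \o f).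
  apply: smooth_linear => //.
    by move=> a x y; congr pair; rewrite /= scaler0 addr0.
  by move=> x; apply: cvg_pair; [exact: cvg_id|exact: cvg_cst].
have sr : smooth_on U ((fun w => (0 : W, w)) \o g).
  apply: smooth_linear => //.
    by move=> a x y; congr pair; rewrite /= scaler0 addr0.
  by move=> x; apply: cvg_pair; [exact: cvg_cst|exact: cvg_id].
have := smoothD oU sl sr; apply: smooth_on_eq => // x _ /=.
by congr pair; rewrite /= ?addr0 ?add0r.
Qed.

Lemma smooth_fst V W (U : set (V * W)) : open U -> smooth_on U fst.
Proof.
move=> oU; apply: (@smooth_linear _ _ _ fst _ id) => //; last exact: smooth_id.
by move=> x; exact: cvg_fst.
Qed.

Lemma smooth_snd V W (U : set (V * W)) : open U -> smooth_on U snd.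
Proof.
move=> oU; apply: (@smooth_linear _ _ _ snd _ id) => //; last exact: smooth_id.
by move=> x; exact: cvg_snd.
Qed.

Lemma smooth_mxP V (U : set V) m n (F : V -> 'M[R]_(m, n)) : open U ->
  smooth_on U F <-> forall i j, smooth_on U (fun x => F x i j : R^o).
Proof.
move=> oU; split=> [sF i j k|sF k]; first exact: (Ck_on_mxP k F oU).1.
by apply/(Ck_on_mxP k F oU) => i j; exact: sF.
Qed.

Lemma smooth_mulmx V (U : set V) m n p (F : V -> 'M[R]_(m, n))
  (G : V -> 'M[R]_(n, p)) : open U ->
  smooth_on U F -> smooth_on U G -> smooth_on U (fun x => F x *m G x).
Proof.
move=> oU /(smooth_mxP _ oU) sF /(smooth_mxP _ oU) sG.
apply/(smooth_mxP _ oU) => i j; under eq_fun do rewrite mxE.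
by apply: smooth_sum => // l; exact: smoothM.
Qed.

Lemma mulmx_continuous m n p :
  continuous (fun q : 'M[R]_(m, n) * 'M[R]_(n, p) => q.1 *m q.2).
Proof.
move=> q; have oT := @openT ('M[R]_(m, n) * 'M[R]_(n, p))%type.
by have /(_ 0%N q I) := smooth_mulmx oT (smooth_fst oT) (smooth_snd oT).
Qed.

Lemma derive_mulmx V m n p (F : V -> 'M[R]_(m, n)) (G : V -> 'M[R]_(n, p)) x v :
  differentiable F x -> differentiable G x ->
  'D_v (fun x => F x *m G x) x = 'D_v F x *m G x + F x *m 'D_v G x.
Proof.
by move=> dF dG; apply: (derive_bilinear (b := mulmx)) => //;
  exact: mulmx_continuous.
Qed.

Lemma smooth_det V (U : set V) n (F : V -> 'M[R]_n) : open U ->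
  smooth_on U F -> smooth_on U (fun x => \det (F x) : R^o).
Proof.
move=> oU /(smooth_mxP _ oU) sF; rewrite /determinant.
apply: smooth_sum => // s; apply: smoothM => //; first exact: smooth_cst.
exact: smooth_prod.
Qed.

(** Cramer's formula: the adjugate is polynomial in the entries and the determinant does not vanish
    on [U]. *)
Lemma smooth_invmx V (U : set V) n (F : V -> 'M[R]_n) : open U ->
  (forall x, U x -> F x \in unitmx) ->
  smooth_on U F -> smooth_on U (fun x => invmx (F x)).
Proof.
move=> oU uF sF; have sF' := (smooth_mxP F oU).1 sF.
have : smooth_on U (fun x => (\det (F x))^-1 *: \adj (F x)).
  apply: smoothZ => //.
    apply: smoothV => //; last exact: smooth_det.
    by move=> x /uF; rewrite unitmxE unitfE.
  apply/(smooth_mxP _ oU) => i j; rewrite /cofactor.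
  under eq_fun do rewrite mxE.
  apply: smoothM => //; first exact: smooth_cst.
  apply: smooth_det => //; apply/(smooth_mxP _ oU) => k l.
  by under eq_fun do rewrite !mxE; exact: sF'.
by apply: smooth_on_eq => // x Ux; rewrite /invmx uF.
Qed.

End Ck.

(** * Charts *)

Section Charts.
Variables (R : realType) (M : manifold R).
Implicit Types (i j k : chart M) (q : M).
Local Notation N := 'rV[R]_(dim M).

Lemma paramP i x : (coord i @` dom i) x ->
  dom i (param i x) /\ coord i (param i x) = x.
Proof. by move=> [q iq <-]; rewrite coordK. Qed.

Lemma chart_image_open i (U : set M) : open U ->
  open (coord i @` (U `&` dom i)).
Proof.
move=> oU; rewrite openE => x [q [Uq iq] <-].
have ic : (coord i @` dom i) (coord i q) by exists q.
have := param_continuous ic => /(_ U); rewrite /= coordK//.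
move=> /(_ (open_nbhs_nbhs (conj oU Uq))) nU.
have nD : nbhs (coord i q) (coord i @` dom i).
  by apply: open_nbhs_nbhs; split => //; exact: coord_dom_open.
rewrite /interior; near=> y.
have [iy yE] : dom i (param i y) /\ coord i (param i y) = y.
  by apply: paramP; near: y.
by exists (param i y) => //; split => //; near: y.
Unshelve. all: by end_near. Qed.

(** The Jacobian at q of the change of charts from [j] to [i]. Both [vcoord] and [vparam] are
    instances in which one chart is the preferred one of q, so their mutual inversion follows from
    the cocycle law [trans_comp]. *)
Definition trans i j q (y : N) : N := 'D_y (coord i \o param j) (coord j q).

Lemma transition_differentiable i j q : dom i q -> dom j q ->
  differentiable (coord i \o param j) (coord j q).
Proof.
move=> iq jq; apply: smooth_differentiable (transition_smooth j i) _.
by exists q.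
Qed.

Lemma near_param i q (P : set M) : nbhs q P -> dom i q ->
  \forall x \near coord i q, P (param i x).
Proof.
move=> nP iq; have ic : (coord i @` dom i) (coord i q) by exists q.
by have := param_continuous ic => /(_ P); rewrite /= coordK//; exact.
Qed.

Lemma near_dom i q : dom i q -> \forall q' \near q, dom i q'.
Proof. by move=> iq; apply: open_nbhs_nbhs; split => //; exact: dom_open. Qed.

Lemma near_paramK i q : dom i q ->
  \forall x \near coord i q, coord i (param i x) = x.
Proof.
move=> iq; have : \forall x \near coord i q, (coord i @` dom i) x.
  by apply: open_nbhs_nbhs; split; [exact: coord_dom_open|exists q].
by apply: filterS => x /paramP[].
Qed.

Lemma trans_comp i j k q y : dom i q -> dom j q -> dom k q ->
  trans i j q (trans j k q y) = trans i k q y.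
Proof.
move=> iq jq kq.
have E : (coord j \o param k) (coord k q) = coord j q by rewrite /= coordK.
have dij := transition_differentiable iq jq.
transitivity ('D_y ((coord i \o param j) \o (coord j \o param k)) (coord k q)).
  rewrite (derive_comp (f := coord i \o param j) (g := coord j \o param k)) ?E//.
  exact: transition_differentiable.
apply: near_eq_derive; near=> x => /=; rewrite coordK//.
by near: x; apply: near_param => //; exact: near_dom.
Unshelve. all: by end_near. Qed.

Lemma trans_id i q y : dom i q -> trans i i q y = y.
Proof.
move=> iq; rewrite /trans -[RHS](derive_id (coord i q) y).
by apply: near_eq_derive; exact: near_paramK.
Qed.

Lemma vcoordE i q : vcoord i q = trans i (chart_at q) q.
Proof. by []. Qed.

Lemma vparamE i q : vparam i q = trans (chart_at q) i q.
Proof. by []. Qed.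

Lemma vcoord_vparam i j q y : dom i q -> dom j q ->
  vcoord i q (vparam j q y) = trans i j q y.
Proof. by move=> iq jq; rewrite vcoordE vparamE trans_comp//; exact: dom_chart_at. Qed.

Lemma vparamK i q y : dom i q -> vcoord i q (vparam i q y) = y.
Proof. by move=> iq; rewrite vcoord_vparam// trans_id. Qed.

Lemma vcoordK i q e : dom i q -> vparam i q (vcoord i q e) = e.
Proof.
by move=> iq; rewrite vcoordE vparamE trans_comp ?trans_id//; exact: dom_chart_at.
Qed.

Lemma vcoord_chart_at q e : vcoord (chart_at q) q e = e.
Proof. by rewrite vcoordE trans_id//; exact: dom_chart_at. Qed.

Lemma ext_id q e : ext q e q = e.
Proof. by rewrite /ext vparamE trans_id//; exact: dom_chart_at. Qed.

Lemma trans_linear i j q : dom i q -> dom j q -> linear (trans i j q).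
Proof.
move=> iq jq a y z; rewrite /trans.
by rewrite derive_dirD ?derive_dirZ//; exact: transition_differentiable.
Qed.

Lemma vcoord_linear i q : dom i q -> linear (vcoord i q).
Proof. by move=> iq; apply: trans_linear => //; exact: dom_chart_at. Qed.

Lemma vparam_linear i q : dom i q -> linear (vparam i q).
Proof. by move=> iq; apply: trans_linear => //; exact: dom_chart_at. Qed.

Lemma vcoord_sum i q (I : Type) (r : seq I) (e : I -> 'T[R]_M) : dom i q ->
  vcoord i q (\sum_(t <- r) e t) = \sum_(t <- r) vcoord i q (e t).
Proof. by move=> /vcoord_linear/linear_pack[l ->]; rewrite linear_sum. Qed.

Lemma vcoordD i q e e' : dom i q ->
  vcoord i q (e + e') = vcoord i q e + vcoord i q e'.
Proof. by move=> /vcoord_linear/linear_pack[l ->]; rewrite linearD. Qed.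

Lemma vcoordB i q e e' : dom i q ->
  vcoord i q (e - e') = vcoord i q e - vcoord i q e'.
Proof. by move=> /vcoord_linear/linear_pack[l ->]; rewrite linearB. Qed.

Lemma vcoordZ i q a e : dom i q -> vcoord i q (a *: e) = a *: vcoord i q e.
Proof. by move=> /vcoord_linear/linear_pack[l ->]; rewrite linearZ. Qed.

Lemma vcoord0 i q : dom i q -> vcoord i q 0 = 0.
Proof. by move=> /vcoord_linear/linear_pack[l ->]; rewrite linear0. Qed.

Lemma vcoord_inj i q : dom i q -> injective (vcoord i q).
Proof. by move=> iq e e' ee'; rewrite -[e](vcoordK _ iq) ee' vcoordK. Qed.

Lemma trans_continuous i j q : dom i q -> dom j q -> continuous (trans i j q).
Proof.
move=> iq jq; have dt := transition_differentiable iq jq.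
rewrite (_ : trans i j q = 'd (coord i \o param j) (coord j q)).
  exact: diff_continuous.
by apply/funext => y; rewrite /trans deriveE.
Qed.

(** In a chart [j] the components are the derivative along [y] of the transition from [i] to [j],
    evaluated through the transition from [j] to [i]. The preferred chart of the moving point
    cancels by the cocycle law. *)
Lemma smooth_vparam i (U : set M) y : open U -> U `<=` dom i ->
  smooth_vfield U (fun q => vparam i q y).
Proof.
move=> oU Ui j.
have oUj : open (coord j @` (U `&` dom j)) by exact: chart_image_open.
have st := smooth_derive y (transition_smooth i j).
have : smooth_on (coord j @` (U `&` dom j))
    ('D_y (coord j \o param i) \o (coord i \o param j)).
  apply: smooth_comp st _ => //; first exact: has_frame_rV.
  - by rewrite setIC; apply: chart_image_open; exact: dom_open.
  - move=> x [q [Uq jq] <-]; exists q; first by split => //; exact: Ui.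
    by rewrite /= coordK.
  - apply: smooth_on_sub (transition_smooth j i) => x [q [Uq jq] <-].
    by exists q => //; split => //; exact: Ui.
apply: smooth_on_eq => // x [q [Uq jq] <-].
by rewrite /= coordK// vcoord_vparam//; exact: Ui.
Qed.

Lemma smooth_fun_coord i (U : set M) (O : set N) (f : N -> R^o) :
  open U -> U `<=` dom i -> open O -> (forall q, U q -> O (coord i q)) ->
  smooth_on O f -> smooth_fun U (fun q => f (coord i q)).
Proof.
move=> oU Ui oO UO sf j.
have oUj : open (coord j @` (U `&` dom j)) by exact: chart_image_open.
have : smooth_on (coord j @` (U `&` dom j)) (f \o (coord i \o param j)).
  apply: smooth_comp sf _ => //; first exact: has_frame_rV.
    by move=> x [q [Uq jq] <-]; rewrite /= coordK//; exact: UO.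
  apply: smooth_on_sub (transition_smooth j i) => x [q [Uq jq] <-].
  by exists q => //; split => //; exact: Ui.
exact: smooth_on_eq.
Qed.

Lemma smooth_vfieldD (U : set M) (E H : vfield M) : open U ->
  smooth_vfield U E -> smooth_vfield U H ->
  smooth_vfield U (fun q => E q + H q).
Proof.
move=> oU sE sH i; have oUi := chart_image_open (i := i) oU.
have := smoothD oUi (sE i) (sH i); apply: smooth_on_eq => //.
by move=> x [q [Uq iq] <-]; rewrite coordK// vcoordD.
Qed.

Lemma smooth_vfieldZ (U : set M) (f : M -> R) (E : vfield M) : open U ->
  smooth_fun U f -> smooth_vfield U E ->
  smooth_vfield U (fun q => f q *: E q).
Proof.
move=> oU sf sE i; have oUi := chart_image_open (i := i) oU.
have := smoothZ oUi (sf i) (sE i); apply: smooth_on_eq => //.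
by move=> x [q [Uq iq] <-]; rewrite /= coordK// vcoordZ.
Qed.

Lemma smooth_vfield0 (U : set M) : open U -> smooth_vfield U (fun=> 0).
Proof.
move=> oU i; have oUi := chart_image_open (i := i) oU.
have := @smooth_cst _ _ _ (coord i @` (U `&` dom i)) (0 : N).
apply: smooth_on_eq => //.
by move=> x [q [Uq iq] <-]; rewrite /= coordK// vcoord0.
Qed.

Lemma smooth_vfield_sum (U : set M) (I : Type) (r : seq I) (E : I -> vfield M) :
  open U -> (forall t, smooth_vfield U (E t)) ->
  smooth_vfield U (fun q => \sum_(t <- r) E t q).
Proof.
move=> oU sE; elim: r => [|t r IH].
  under eq_fun do rewrite big_nil; exact: (smooth_vfield0 oU).
under eq_fun do rewrite big_cons; exact: (smooth_vfieldD oU (sE t) IH).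
Qed.

Lemma dfun_coord i q (f : N -> R^o) e : dom i q ->
  differentiable f (coord i q) ->
  dfun (fun q => f (coord i q)) q e = 'D_(vcoord i q e) f (coord i q).
Proof.
move=> iq df; have dq := dom_chart_at q.
have dt := transition_differentiable iq dq.
rewrite /dfun /vcoord.
have E : (coord i \o param (chart_at q)) (coord (chart_at q) q) = coord i q.
  by rewrite /= coordK.
by rewrite -[in RHS]E -derive_comp// E.
Qed.

Definition frame i (a : 'I_(dim M)) : vfield M :=
  fun q => vparam i q (delta_mx 0 a).

Lemma smooth_frame i (U : set M) a : open U -> U `<=` dom i ->
  smooth_vfield U (frame i a).
Proof. exact: smooth_vparam. Qed.

Lemma frame_sum i q y : dom i q ->
  vparam i q y = \sum_a y 0 a *: frame i a q.
Proof.
move=> iq; rewrite {1}(row_sum_delta y).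
have [l El] := linear_pack (vparam_linear iq).
by rewrite El linear_sum; apply: eq_bigr => a _; rewrite linearZ /frame El.
Qed.

End Charts.

(** * Connections in a chart *)

Lemma derive_pair (R : realType) (V W W' : normedModType R) (f : V -> W)
    (g : V -> W') x v : differentiable f x -> differentiable g x ->
  'D_v (fun x => (f x, g x)) x = ('D_v f x, 'D_v g x).
Proof.
move=> df dg; rewrite !deriveE//; last exact: differentiable_pair.
by rewrite diff_pair.
Qed.

Lemma linear_derive (R : realType) (V W : normedModType R) (l : V -> W) x v :
  linear l -> continuous l -> differentiable l x /\ 'D_v l x = l v.
Proof.
move=> /linear_pack[l' ->] cl; have dl := linear_differentiable x cl.
by split=> //; rewrite deriveE// diff_lin.
Qed.

Section Connection.
Variables (R : realType) (M : manifold R) (A : tset M) (nabla : connection M).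
Hypothesis hn : anisotropic_connection A nabla.
Variable c : chart M.
Local Notation N := 'rV[R]_(dim M).
Implicit Types (q : M) (v e : 'T[R]_M).

Lemma nabla_sumr (U : set M) (I : Type) (r : seq I) (f : I -> M -> R)
    (E : vfield M) (H : I -> vfield M) q v :
  open U -> (forall t, smooth_fun U (f t)) -> smooth_vfield U E ->
  (forall t, smooth_vfield U (H t)) -> U q -> A q v ->
  nabla E (fun q => \sum_(t <- r) f t q *: H t q) q v =
  \sum_(t <- r) (dfun (f t) q (E q) *: H t q + f t q *: nabla E (H t) q v).
Proof.
move=> oU sf sE sH Uq Av; elim: r => [|t r IH].
  (* Additivity applied to 0 + 0 = 0 forces the covariant derivative of the zero field to vanish. *)
  rewrite big_nil; under eq_fun do rewrite big_nil.
  have s0 := smooth_vfield0 oU.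
  have := nabla_additiver hn oU sE s0 s0 Uq Av.
  under eq_fun do rewrite addr0.
  by move=> /(canLR (addrK _)); rewrite subrr.
under eq_fun do rewrite big_cons.
rewrite big_cons -IH (nabla_additiver hn oU sE _ _ Uq Av).
- by rewrite (nabla_leibniz hn oU (sf t) sE (sH t) Uq Av).
- exact: (smooth_vfieldZ oU (sf t) (sH t)).
- exact: (smooth_vfield_sum r oU
    (fun t => smooth_vfieldZ oU (sf t) (sH t))).
Qed.

Lemma nabla_suml (U : set M) (I : Type) (r : seq I) (f : I -> M -> R)
    (E : I -> vfield M) (H : vfield M) q v :
  open U -> (forall t, smooth_fun U (f t)) ->
  (forall t, smooth_vfield U (E t)) -> smooth_vfield U H -> U q -> A q v ->
  nabla (fun q => \sum_(t <- r) f t q *: E t q) H q v =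
  \sum_(t <- r) f t q *: nabla (E t) H q v.
Proof.
move=> oU sf sE sH Uq Av; elim: r => [|t r IH].
  rewrite big_nil; under eq_fun do rewrite big_nil.
  have s0 := smooth_vfield0 oU.
  have := nabla_additivel hn oU s0 s0 sH Uq Av.
  under eq_fun do rewrite addr0.
  by move=> /(canLR (addrK _)); rewrite subrr.
under eq_fun do rewrite big_cons.
rewrite big_cons -IH (nabla_additivel hn oU _ _ sH Uq Av).
- by rewrite (nabla_scalel hn oU (sf t) (sE t) sH Uq Av).
- exact: (smooth_vfieldZ oU (sf t) (sE t)).
- exact: (smooth_vfield_sum r oU
    (fun t => smooth_vfieldZ oU (sf t) (sE t))).
Qed.

(** The field with components [f], written as a combination of the coordinate fields so that
    additivity and the Leibniz rule apply term by term. *)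
Definition coord_field (f : N -> N) : vfield M :=
  fun q => \sum_a f (coord c q) 0 a *: frame c a q.

Lemma coord_fieldE (f : N -> N) q e : dom c q ->
  vcoord c q e = f (coord c q) -> e = coord_field f q.
Proof. by move=> cq fE; rewrite /coord_field -fE -frame_sum// vcoordK. Qed.

Lemma smooth_coord_fun (U : set M) (O : set N) (f : N -> N) a :
  open U -> U `<=` dom c -> open O -> (forall q, U q -> O (coord c q)) ->
  smooth_on O f -> smooth_fun U (fun q => f (coord c q) 0 a).
Proof.
move=> oU Uc oO UO /(smooth_mxP _ oO) sf.
exact: (smooth_fun_coord oU Uc oO UO (sf 0 a)).
Qed.

Lemma smooth_coord_field (U : set M) (O : set N) (f : N -> N) :
  open U -> U `<=` dom c -> open O -> (forall q, U q -> O (coord c q)) ->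
  smooth_on O f -> smooth_vfield U (coord_field f).
Proof.
move=> oU Uc oO UO sf; apply: smooth_vfield_sum => // a.
apply: smooth_vfieldZ => //; last exact: smooth_frame.
exact: smooth_coord_fun sf.
Qed.

Definition vrep (H : vfield M) (x : N) : N := vcoord c (param c x) (H (param c x)).

Lemma smooth_vrep_ext q e :
  smooth_on (coord c @` (dom (chart_at q) `&` dom c)) (vrep (ext q e)).
Proof.
have := @smooth_vparam _ _ (chart_at q) (dom (chart_at q)) e.
by apply => //; exact: dom_open.
Qed.

Lemma vrepE (H : vfield M) q : dom c q -> vrep H (coord c q) = vcoord c q (H q).
Proof. by move=> cq; rewrite /vrep coordK. Qed.

Lemma open_dom2 i j : open (dom i `&` dom j : set M).
Proof. by apply: openI; exact: dom_open. Qed.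

(* The matrices of Christoffel symbols in the chart c, acting on row vectors:
   row b of christoffel a z represents nabla^v_(frame a) (frame b). *)
Definition christoffel (a : 'I_(dim M)) (z : (N * N)%type) : 'M[R]_(dim M) :=
  \matrix_(b < dim M) vcoord c (param c z.1)
    (nabla (frame c a) (frame c b) (param c z.1) (vparam c (param c z.1) z.2)).

(** The connection form of [nabla] at [z] evaluated on [h]: right multiplication of a row of
    components by it is the zeroth order part of the covariant derivative along [h]. *)
Definition conn_mx (z : (N * N)%type) (h : N) : 'M[R]_(dim M) :=
  \sum_a h 0 a *: christoffel a z.

Lemma smooth_christoffel a : open (tchart A c) ->
  smooth_on (tchart A c) (christoffel a).
Proof.
move=> oA; apply/(smooth_mxP _ oA) => b k.
have oc := dom_open c.
have sub : dom c `<=` dom c by [].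
have := nabla_smooth hn oc (smooth_frame a oc sub) (smooth_frame b oc sub).
move=> /(_ c) /(smooth_on_sub (U := tchart A c)) sn.
have {}sn := sn _; have /sn /(smooth_mxP _ oA) /(_ 0 k) : 
   tchart A c `<=` tchart (fun p v => dom c p /\ A p v) c.
  by move=> z [/[dup] cz /paramP[? _] Az]; split.
by apply: smooth_on_eq => // z _; rewrite !mxE.
Qed.

(** [nabla_at] extends [e] by constants in the preferred chart of q, not in [c]. By locality this
    extension may be replaced by its expansion in the frame of [c], and linearity over functions
    then leaves only its value at q. *)
Lemma nabla_at_frame q v e b : dom c q -> A q v ->
  vcoord c q (nabla_at nabla (frame c b) q v e) =
  row b (conn_mx (coord c q, vcoord c q v) (vcoord c q e)).
Proof.
move=> cq Av; set d := chart_at q; set U := dom c `&` dom d.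
have oU : open U := @open_dom2 c d.
have Uc : U `<=` dom c by move=> ? [].
have oO := chart_image_open (i := c) (dom_open d).
have UO q' : U q' -> (coord c @` (dom d `&` dom c)) (coord c q').
  by move=> [? ?]; exists q'.
have sf := smooth_vrep_ext q e.
have Uq : U q by split => //; exact: dom_chart_at.
have extE q' : U q' -> coord_field (vrep (ext q e)) q' = ext q e q'.
  by move=> [cq' _]; rewrite -(coord_fieldE cq' (esym (vrepE _ cq'))).
rewrite /nabla_at -(nabla_local hn oU _ _ extE (fun _ _ => erefl) Uq Av); last 2 first.
- exact: smooth_coord_field sf.
- exact: smooth_frame.
have -> := nabla_suml (index_enum 'I_(dim M)) oU
  (fun a => smooth_coord_fun a oU Uc oO UO sf)
  (fun a => smooth_frame a oU Uc) (smooth_frame b oU Uc) Uq Av.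
rewrite (vrepE _ cq) ext_id (vcoord_sum _ _ cq) /conn_mx linear_sum.
apply: eq_bigr => a _.
rewrite (vcoordZ _ _ cq) [RHS]linearZ /=; congr (_ *: _).
by rewrite rowK /= (coordK cq) (vcoordK _ cq).
Qed.

Lemma nabla_atE (H : vfield M) (O : set N) (f : N -> N) q v e :
  dom c q -> A q v -> open O -> O (coord c q) -> smooth_on O f ->
  (\forall q' \near q, vcoord c q' (H q') = f (coord c q')) ->
  vcoord c q (nabla_at nabla H q v e) =
  'D_(vcoord c q e) f (coord c q) +
  f (coord c q) *m conn_mx (coord c q, vcoord c q v) (vcoord c q e).
Proof.
move=> cq Av oO Oq sf Hf; set d := chart_at q.
(* The connection axioms are stated over open sets, so all local data (both charts, the domain of
   [f], the formula for [H]) are gathered in a neighbourhood of q, whose interior is used. *)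
pose U0 := [set q' | (dom c `&` dom d) q' /\ O (coord c q') /\
  vcoord c q' (H q') = f (coord c q')].
have nU : nbhs q U0.
  apply: filterI.
    by apply: open_nbhs_nbhs; split; [exact: open_dom2|split => //; exact: dom_chart_at].
  apply: filterI => //.
  by have := coord_continuous cq => /(_ O); apply; exact: open_nbhs_nbhs.
pose U := interior U0.
have oU : open U := @open_interior _ _.
have UU0 : U `<=` U0 := @interior_subset _ _.
have Uq : U q := nU.
have Uc : U `<=` dom c by move=> ? /UU0[[]].
have Ud : U `<=` dom d by move=> ? /UU0[[]].
have UO q' : U q' -> O (coord c q') by move=> /UU0[_ []].
have HE q' : U q' -> coord_field f q' = H q'.
  by move=> Uq'; symmetry; apply: coord_fieldE; [exact: Uc|have [_ []] := UU0 _ Uq'].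
have sE : smooth_vfield U (ext q e) by exact: smooth_vparam.
have sc := smooth_coord_field oU Uc oO UO sf.
rewrite /nabla_at -(nabla_local hn oU sE sc (fun _ _ => erefl) HE Uq Av).
have -> := nabla_sumr (index_enum 'I_(dim M)) oU
  (fun a => smooth_coord_fun a oU Uc oO UO sf) sE
  (fun a => smooth_frame a oU Uc) Uq Av.
rewrite ext_id big_split /= (vcoordD _ _ cq) !(vcoord_sum _ _ cq); congr (_ + _).
  rewrite [RHS]row_sum_delta; apply: eq_bigr => a _.
  rewrite vcoordZ// /frame vparamK//; congr (_ *: _).
  have df := smooth_differentiable sf Oq.
  have dfa : differentiable (fun x => f x 0 a : R^o) (coord c q).
    exact: (smooth_differentiable ((smooth_mxP _ oO).1 sf 0 a) Oq).
  rewrite (dfun_coord (f := fun x => f x 0 a : R^o))//.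
  by rewrite derive_mx ?mxE//; exact: diff_derivable.
rewrite mulmx_sum_row; apply: eq_bigr => a _.
by rewrite vcoordZ// -nabla_at_frame.
Qed.

(** The extension V of v enters twice: [X' \o g] is differentiated along (e', dV), and the fiber
    derivative along (0, dV + v G) is subtracted. In the difference dV disappears and the horizontal
    lift (e', - v G) remains. *)
Lemma cov_fieldE (X : avfield M) (X' : (N * N)%type -> N)
    (O : set (N * N)%type) q v e :
  let z := (coord c q, vcoord c q v) in let e' := vcoord c q e in
  dom c q -> A q v -> open O -> O z -> smooth_on O X' ->
  (forall q' v', dom c q' -> O (coord c q', vcoord c q' v') ->
     vcoord c q' (X q' v') = X' (coord c q', vcoord c q' v')) ->
  vcoord c q (cov_field nabla X q v e) =
  'D_(e', - (vcoord c q v *m conn_mx z e')) X' z + X' z *m conn_mx z e'.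
Proof.
move=> z e' cq Av oO Oz sX XE; rewrite /cov_field vcoordB//.
set d := chart_at q; set V := ext q v.
have dX := smooth_differentiable sX Oz.
pose O0 := coord c @` (dom d `&` dom c).
have oO0 : open O0 := chart_image_open (i := c) (dom_open d).
have O0q : O0 (coord c q) by exists q => //; split => //; exact: dom_chart_at.
have sV : smooth_on O0 (vrep V) := smooth_vrep_ext q v.
have Vq : vrep V (coord c q) = vcoord c q v by rewrite (vrepE _ cq) /V ext_id.
have dV := smooth_differentiable sV O0q.
have nabV := nabla_atE e cq Av oO0 O0q sV _.
have {}nabV : vcoord c q (nabla_at nabla V q v e) =
   'D_e' (vrep V) (coord c q) + vcoord c q v *m conn_mx z e'.
  rewrite nabV ?Vq//; apply: filterS (near_dom cq) => q' cq'.
  by rewrite vrepE.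
pose g x := (x, vrep V x).
have sg : smooth_on O0 g by apply: smooth_pair => //; exact: smooth_id.
have gq : g (coord c q) = z by rewrite /g Vq.
have dg := smooth_differentiable sg O0q.
pose O1 := interior (O0 `&` g @^-1` O).
have oO1 : open O1 := @open_interior _ _.
have O1q : O1 (coord c q).
  apply: filterI; first exact: (open_nbhs_nbhs (conj oO0 O0q)).
  have := differentiable_continuous dg; apply; apply: open_nbhs_nbhs.
  by split; rewrite ?gq.
have sO1 : O1 `<=` O0 `&` g @^-1` O := @interior_subset _ _.
have sXg : smooth_on O1 (X' \o g).
  have fN := has_frame_rV R (dim M).
  apply: (smooth_comp (has_frame_prod fN fN) oO1 oO _ sX).
    by move=> x /sO1[].
  by apply: smooth_on_sub sg => x /sO1[].
have nXV : \forall q' \near q,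
    vcoord c q' (X q' (V q')) = (X' \o g) (coord c q').
  have nO : \forall q' \near q, O1 (coord c q').
    have := coord_continuous cq => /(_ O1); apply.
    exact: (open_nbhs_nbhs (conj oO1 O1q)).
  apply: filterS (filterI nO (near_dom cq)) => q' [hO cq'].
  have [_ Og] := sO1 _ hO.
  move: Og; rewrite /comp /preimage /= /g (vrepE _ cq') => Og.
  exact: (XE _ _ cq' Og).
have := nabla_atE e cq Av oO1 O1q sXg nXV.
rewrite -/z -/e' [(X' \o g) _](_ : _ = X' z); last by rewrite /comp gq.
move=> ->; rewrite addrAC; congr (_ + _).
have dX' : differentiable X' (g (coord c q)) by rewrite gq.
rewrite (derive_comp _ dg dX') gq.
have -> : 'D_e' g (coord c q) = (e', 'D_e' (vrep V) (coord c q)).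
  have := derive_pair e' (@ex_diff _ _ _ _ _ _ _ (is_diff_id (coord c q))) dV.
  by rewrite derive_id.
(* The fiber derivative keeps the base point, so in the chart it is the derivative of [X'] along a
   vector with zero first component; the linear maps [vcoord] and [vparam] at q commute with it. *)
have -> : vcoord c q ('D_(nabla_at nabla V q v e) (X q) v) =
    'D_(0, vcoord c q (nabla_at nabla V q v e)) X' z.
  set w := nabla_at _ _ _ _ _.
  have [dl Dl] := linear_derive v w (vcoord_linear cq)
    (trans_continuous cq (dom_chart_at q)).
  pose l v' := (coord c q, vcoord c q v').
  have dp : differentiable l v.
    exact: (differentiable_pair (differentiable_cst (coord c q) v) dl).
  have XqE : \forall v' \near v, X q v' = (vparam c q \o (X' \o l)) v'.
    have : \forall v' \near v, O (l v').
      have := differentiable_continuous dp; apply.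
      exact: (open_nbhs_nbhs (conj oO Oz)).
    apply: filterS => v' Ol.
    by rewrite /comp -(XE _ _ cq Ol) (vcoordK _ cq).
  have dXl' : differentiable X' (l v) := dX.
  have dXl := differentiable_comp dp dXl'.
  rewrite (near_eq_derive _ XqE).
  have ck := trans_continuous (dom_chart_at q) cq.
  have [k Ek] := linear_pack (vparam_linear cq).
  rewrite Ek (derive_linear _ (diff_derivable dXl)); last by rewrite -Ek.
  rewrite -Ek (vparamK _ cq) (derive_comp _ dp dXl'); congr ('D_ _ _ _).
  have := derive_pair w (differentiable_cst (coord c q) v) dl.
  by rewrite derive_cst Dl.
rewrite nabV; set y := 'D_e' (vrep V) (coord c q); set k := _ *m _.
(* Here [y] is the derivative of V; it cancels between the two directions. *)
have -> : (e', - k) = (e', y) + (-1) *: (0, y + k) :> N * N.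
  by congr pair; rewrite /= ?scaler0 ?addr0// scaleN1r opprD addrA subrr add0r.
by rewrite (derive_dirD _ _ dX) (derive_dirZ _ _ dX) scaleN1r.
Qed.

End Connection.

(** * The vertical projection *)

Section OrthogonalProjection.
Variables (F : fieldType) (n m : nat) (G : 'M[F]_n) (S : 'M[F]_(n, m)).

(* A row t is the G-orthogonal projection of e on the left kernel of S iff
   t *m G + l *m S^T = e *m G and t *m S = 0 for some multiplier l. *)
Definition proj_system : 'M[F]_(n + m) := block_mx G S S^T 0.

(** Row e of the right-hand side is (e G, 0), and the columns holding the multipliers are discarded.
    Being rational in [G] and [S], this form makes the smoothness of the projection accessible. *)
Definition kerproj : 'M[F]_n :=
  lsubmx (row_mx G (0 : 'M[F]_(n, m)) *m invmx proj_system).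

Hypothesis S_surj : forall f : 'rV_m, exists e : 'rV_n, e *m S = f.
Hypothesis G_nondeg : forall t : 'rV_n, t *m S = 0 ->
  (forall w : 'rV_n, w *m S = 0 -> t *m G *m w^T = 0) -> t = 0.

(** Let (t, l) be in the left kernel. Then t lies in the left kernel of [S], and t G = - l S^T pairs
    to zero with that kernel, so non-degeneracy gives t = 0. What remains is l S^T = 0, and
    surjectivity of [S] gives l = 0. *)
Lemma proj_system_unit : proj_system \in unitmx.
Proof.
rewrite -row_free_unit; apply: inj_row_free => r.
rewrite -[r]hsubmxK /proj_system mul_row_block mulmx0 addr0.
set t := lsubmx r; set l := rsubmx r.
move=> /eqP; rewrite row_mx_eq0 => /andP[/eqP tl /eqP tS].
have t0 : t = 0.
  apply: G_nondeg => // w wS; move/eqP: tl; rewrite addr_eq0 => /eqP ->.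
  by rewrite mulNmx -mulmxA -trmx_mul wS trmx0 mulmx0 oppr0.
rewrite t0 mul0mx add0r in tl; rewrite t0.
suff -> : l = 0 by rewrite row_mx0.
apply/rowP => a; have [e eS] := S_surj (delta_mx 0 a).
have : l *m S^T *m e^T = 0 by rewrite tl mul0mx.
rewrite -mulmxA -trmx_mul eS trmx_delta -colE.
by move=> /matrixP/(_ 0 0); rewrite !mxE.
Qed.

Lemma kerprojP (e : 'rV_n) : e *m kerproj *m S = 0 /\
  forall w : 'rV_n, w *m S = 0 -> (e - e *m kerproj) *m G *m w^T = 0.
Proof.
set X := row_mx G 0 *m invmx proj_system.
have : e *m X *m proj_system = row_mx (e *m G) 0.
  by rewrite /X -!mulmxA mulVmx ?proj_system_unit// mulmx1 mul_mx_row mulmx0.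
rewrite -[e *m X]hsubmxK /proj_system mul_row_block mulmx0 addr0.
have -> : lsubmx (e *m X) = e *m kerproj by rewrite /kerproj -/X mulmx_lsub.
move=> /eq_row_mx[tl tS]; split=> // w wS.
rewrite mulmxBl -tl addrAC subrr add0r.
by rewrite -mulmxA -trmx_mul wS trmx0 mulmx0.
Qed.

Lemma kerproj_uniq (e t : 'rV_n) : t *m S = 0 ->
  (forall w : 'rV_n, w *m S = 0 -> (e - t) *m G *m w^T = 0) ->
  e *m kerproj = t.
Proof.
move=> tS et; have [pS ep] := kerprojP e.
apply/eqP; rewrite -subr_eq0; apply/eqP; apply: G_nondeg.
  by rewrite mulmxBl pS tS subrr.
move=> w wS; have -> : e *m kerproj - t = (e - t) - (e - e *m kerproj).
  by rewrite opprB [RHS]addrC addrA subrK.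
by rewrite mulmxBl mulmxBl (et w wS) (ep w wS) subrr.
Qed.

End OrthogonalProjection.

(** The two difference quotients coincide, so no differentiability is involved. The identity thus
    holds in non-admissible directions too and can be used between functions before a second
    differentiation. *)
Lemma derive_affine (R : realType) (V V' W : normedModType R) (f : V -> W)
    (g : V' -> V) a v w :
  (forall t, g (t *: v + a) = t *: w + g a) ->
  'D_v (f \o g) a = 'D_w f (g a).
Proof.
by move=> gE; rewrite /derive; under eq_fun do rewrite /= gE.
Qed.

Lemma pair0_sum (R : realType) (V : normedModType R) n (y : 'rV[R]_n) :
  (0 : V, y) = \sum_a y 0 a *: (0 : V, delta_mx 0 a : 'rV[R]_n).
Proof.
have [l El] : exists l : {linear 'rV[R]_n -> (V * 'rV[R]_n)%type},
    (fun y => (0, y)) = l.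
  by apply: linear_pack => a x z; congr pair; rewrite /= scaler0 addr0.
rewrite -[LHS]/((fun y : 'rV[R]_n => (0 : V, y)) y) El [in LHS](row_sum_delta y).
by rewrite linear_sum; apply: eq_bigr => a _; rewrite linearZ -El.
Qed.

Section SmoothBlocks.
Variables (R : realType) (V : normedModType R) (U : set V).
Hypothesis oU : open U.

Lemma smooth_trmx m n (F : V -> 'M[R]_(m, n)) :
  smooth_on U F -> smooth_on U (fun x => (F x)^T).
Proof.
move=> /(smooth_mxP _ oU) sF; apply/(smooth_mxP _ oU) => i j.
by under eq_fun do rewrite mxE; exact: sF.
Qed.

Lemma smooth_row_mx m n1 n2 (F : V -> 'M[R]_(m, n1)) (G : V -> 'M[R]_(m, n2)) :
  smooth_on U F -> smooth_on U G -> smooth_on U (fun x => row_mx (F x) (G x)).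
Proof.
move=> /(smooth_mxP _ oU) sF /(smooth_mxP _ oU) sG.
apply/(smooth_mxP _ oU) => i j; under eq_fun do rewrite mxE.
by case: (fintype.split j) => k; [exact: sF|exact: sG].
Qed.

Lemma smooth_col_mx m1 m2 n (F : V -> 'M[R]_(m1, n)) (G : V -> 'M[R]_(m2, n)) :
  smooth_on U F -> smooth_on U G -> smooth_on U (fun x => col_mx (F x) (G x)).
Proof.
move=> /(smooth_mxP _ oU) sF /(smooth_mxP _ oU) sG.
apply/(smooth_mxP _ oU) => i j; under eq_fun do rewrite mxE.
by case: (fintype.split i) => k; [exact: sF|exact: sG].
Qed.

Lemma smooth_lsubmx m n1 n2 (F : V -> 'M[R]_(m, n1 + n2)) :
  smooth_on U F -> smooth_on U (fun x => lsubmx (F x)).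
Proof.
move=> /(smooth_mxP _ oU) sF; apply/(smooth_mxP _ oU) => i j.
by under eq_fun do rewrite mxE; exact: sF.
Qed.

End SmoothBlocks.

(** * The submersion, the metric and the vertical projection in charts *)

Section Submersion.
Variables (R : realType) (M B : manifold R) (s : M -> B) (A : tset M)
  (L : afun M) (A' : tset B) (L' : afun B).
Hypothesis hL : pseudo_finsler A L.
Hypothesis hs : pseudo_finsler_submersion s A L A' L'.
Hypothesis hnd : vertical_nondegenerate s A L.
Variables (c : chart M) (d : chart B).
Local Notation N := 'rV[R]_(dim M).
Implicit Types (q : M) (v e : 'T[R]_M).

Definition adapted : set M := dom c `&` s @^-1` dom d.

Lemma adapted_open : open adapted.
Proof.
apply: openI; first exact: dom_open.
have [cs _] := submersion_smooth hs.
by move/continuousP: cs; apply; exact: dom_open.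
Qed.

Definition adapted_image : set N := coord c @` adapted.

Lemma adapted_image_open : open adapted_image.
Proof.
rewrite /adapted_image (_ : adapted = adapted `&` dom c).
  exact/chart_image_open/adapted_open.
by apply/seteqP; split=> [q [cq ?]|q []].
Qed.

Definition sub_rep : N -> 'rV[R]_(dim B) := coord d \o s \o param c.

Lemma smooth_sub_rep : smooth_on adapted_image sub_rep.
Proof. by have [_] := submersion_smooth hs; exact. Qed.

Lemma dmapE q e : adapted q ->
  dmap s q e = vparam d (s q) ('D_(vcoord c q e) sub_rep (coord c q)).
Proof.
move=> [cq dq]; set c' := chart_at q; set d' := chart_at (s q).
have c'q : dom c' q := dom_chart_at q.
have d'q : dom d' (s q) := dom_chart_at (s q).
have dc := transition_differentiable cq c'q.
have dd := transition_differentiable d'q dq.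
have E1 : (coord c \o param c') (coord c' q) = coord c q by rewrite /= coordK.
have E2 : sub_rep (coord c q) = coord d (s q) by rewrite /sub_rep /= coordK.
have E3 : (sub_rep \o (coord c \o param c')) (coord c' q) = coord d (s q).
  by rewrite -E2 -E1.
have ds : differentiable sub_rep (coord c q).
  by apply: smooth_differentiable smooth_sub_rep _; exists q.
have dsc : differentiable (sub_rep \o (coord c \o param c')) (coord c' q).
  by apply: differentiable_comp; rewrite ?E1.
(* [dmap] uses the preferred charts of q and s q; [c] and [d] are inserted between them, so that the
   chain rule produces one Jacobian at each end. *)
transitivity ('D_e ((coord d' \o param d) \o
    (sub_rep \o (coord c \o param c'))) (coord c' q)).
  apply: near_eq_derive; near=> x; rewrite /sub_rep /=.
  have [cx dx] : adapted (param c' x).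
    near: x; apply: near_param => //; apply: open_nbhs_nbhs.
    by split => //; exact: adapted_open.
  by rewrite !coordK.
have dd' : differentiable (coord d' \o param d)
    ((sub_rep \o (coord c \o param c')) (coord c' q)).
  by rewrite [X in differentiable _ X]E3.
rewrite (derive_comp _ dsc dd') E3 (derive_comp _ dc _) ?E1//.
Unshelve. all: by end_near. Qed.

(** The transposed Jacobian of s: since it acts on rows, its left kernel is the vertical space. *)
Definition sub_mx (x : N) : 'M[R]_(dim M, dim B) :=
  \matrix_(a < dim M) 'D_(delta_mx 0 a) sub_rep x.

Lemma smooth_sub_mx : smooth_on adapted_image sub_mx.
Proof.
have oI := adapted_image_open; apply/(smooth_mxP _ oI) => a b.
have /(smooth_mxP _ oI)/(_ 0 b) := smooth_derive (delta_mx 0 a) smooth_sub_rep.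
by apply: smooth_on_eq => // x _; rewrite !mxE.
Qed.

Lemma sub_mxE x e : adapted_image x -> 'D_e sub_rep x = e *m sub_mx x.
Proof.
move=> Ix; have ds := smooth_differentiable smooth_sub_rep Ix.
rewrite mulmx_sum_row [in LHS](row_sum_delta e) derive_dir_sum//.
by apply: eq_bigr => a _; rewrite derive_dirZ// rowK.
Qed.

Lemma verticalE q e : adapted q ->
  vertical s q e <-> vcoord c q e *m sub_mx (coord c q) = 0.
Proof.
move=> aq; have [cq dq] := aq.
rewrite /vertical dmapE// sub_mxE; last by exists q.
split=> [|->].
  by move=> /(congr1 (vcoord d (s q))); rewrite vparamK// vcoord0.
by have [l ->] := linear_pack (vparam_linear dq); rewrite linear0.
Qed.

Lemma sub_mx_surj q (f : 'rV[R]_(dim B)) : adapted q ->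
  exists e : N, e *m sub_mx (coord c q) = f.
Proof.
move=> aq; have [cq dq] := aq.
have [e] := submersion_dsurjective hs q (vparam d (s q) f).
rewrite (dmapE _ aq) => /(congr1 (vcoord d (s q))).
rewrite !(vparamK _ dq) => ef.
by exists (vcoord c q e); rewrite -sub_mxE//; exists q.
Qed.

Definition metric_rep (z : (N * N)%type) : R^o :=
  L (param c z.1) (vparam c (param c z.1) z.2).

Definition metric_mx (z : (N * N)%type) : 'M[R]_(dim M) :=
  \matrix_(a, b) (2^-1 * 'D_(0, delta_mx 0 a)
    ('D_(0, delta_mx 0 b) metric_rep) z).

Lemma tchart_open : open (tchart A c).
Proof. by have [_ oA _ _ _ _] := hL; exact: oA. Qed.

Lemma smooth_metric_rep : smooth_on (tchart A c) metric_rep.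
Proof. by have [_ _ _ sL _ _] := hL; exact: sL. Qed.

Lemma smooth_metric_mx : smooth_on (tchart A c) metric_mx.
Proof.
have oA := tchart_open; apply/(smooth_mxP _ oA) => a b.
under eq_fun do rewrite mxE.
apply: smoothM => //; first exact: smooth_cst.
exact/smooth_derive/smooth_derive/smooth_metric_rep.
Qed.

Lemma tchartE q v : dom c q -> A q v -> tchart A c (coord c q, vcoord c q v).
Proof. by move=> cq Av; split; [exists q|rewrite /= coordK// vcoordK]. Qed.

Lemma fundamentalE q v e h : dom c q -> A q v ->
  fundamental L q v e h = (vcoord c q e *m
    metric_mx (coord c q, vcoord c q v) *m (vcoord c q h)^T) 0 0.
Proof.
move=> cq Av; pose g v' := (coord c q, vcoord c q v').
have gE w v' t : g (t *: w + v') = t *: (0, vcoord c q w) + g v'.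
  congr pair; first by rewrite /= scaler0 add0r.
  by rewrite /= vcoordD// vcoordZ.
have Lg : (L q : 'T[R]_M -> R^o) = metric_rep \o g.
  by apply/funext => v'; rewrite /metric_rep /= coordK// vcoordK.
rewrite /fundamental Lg.
have -> : 'D_h (metric_rep \o g) = 'D_(0, vcoord c q h) metric_rep \o g.
  by apply/funext => v'; exact: derive_affine.
rewrite (derive_affine _ (gE e v)).
have oA := tchart_open.
have Az : tchart A c (g v) := tchartE cq Av.
have sD b : smooth_on (tchart A c) ('D_(0, delta_mx 0 b) metric_rep).
  exact/smooth_derive/smooth_metric_rep.
have -> : 'D_(0, vcoord c q e) ('D_(0, vcoord c q h) metric_rep) (g v) =
   \sum_b vcoord c q h 0 b *: 'D_(0, vcoord c q e)
      ('D_(0, delta_mx 0 b) metric_rep) (g v).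
  (* The inner derivative is differentiated again, so its expansion in the basis must hold near
     [g v] and not only at that point. *)
  transitivity ('D_(0, vcoord c q e) (\sum_b vcoord c q h 0 b \*: 
      'D_(0, delta_mx 0 b) metric_rep) (g v)).
    apply: near_eq_derive; near=> z.
    have Az' : tchart A c z by near: z; exact: open_nbhs_nbhs.
    rewrite pair0_sum derive_dir_sum; last exact: smooth_differentiable smooth_metric_rep _.
    rewrite fct_sumE; apply: eq_bigr => b _.
    by rewrite derive_dirZ//; exact: smooth_differentiable smooth_metric_rep _.
  rewrite derive_sum => [|b]; last first.
    by apply: derivableZ; apply: diff_derivable; exact: smooth_differentiable (sD b) _.
  apply: eq_bigr => b _; rewrite deriveZ//.
  by apply: diff_derivable; exact: smooth_differentiable (sD b) _.
rewrite mxE mulr_sumr; apply: eq_bigr => b _.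
rewrite mxE mulrC -[in RHS]mulrC -mulrA !mxE; congr (_ * _).
rewrite (pair0_sum _ (vcoord c q e)) derive_dir_sum; last exact: smooth_differentiable (sD b) _.
rewrite mulr_suml; apply: eq_bigr => a _; rewrite mxE derive_dirZ.
  by rewrite -mulrA; congr (_ * _); rewrite mulrC.
exact: smooth_differentiable (sD b) _.
Unshelve. all: by end_near. Qed.

Definition vpart_mx (z : (N * N)%type) : 'M[R]_(dim M) :=
  kerproj (metric_mx z) (sub_mx z.1).

Definition adapted_tchart : set (N * N)%type :=
  tchart A c `&` fst @^-1` adapted_image.

Lemma adapted_tchart_open : open adapted_tchart.
Proof.
apply: openI; first exact: tchart_open.
have /continuousP : continuous (@fst N N) by move=> x; exact: cvg_fst.
by apply; exact: adapted_image_open.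
Qed.

Lemma adapted_tchartP z : adapted_tchart z ->
  exists q v, [/\ adapted q, A q v & z = (coord c q, vcoord c q v)].
Proof.
case: z => x y [[/= _ Av] [q aq qx]]; have [cq dq] := aq.
move: Av; rewrite -qx /= coordK// => Av.
by exists q, (vparam c q y); rewrite vparamK.
Qed.

Lemma adapted_tchartE q v : adapted q -> A q v ->
  adapted_tchart (coord c q, vcoord c q v).
Proof. by move=> aq Av; split; [apply: tchartE => //; case: aq|exists q]. Qed.

Lemma metric_mx_nondegenerate q v (t : N) : adapted q -> A q v ->
  let z := (coord c q, vcoord c q v) in t *m sub_mx z.1 = 0 ->
  (forall w : N, w *m sub_mx z.1 = 0 -> t *m metric_mx z *m w^T = 0) -> t = 0.
Proof.
move=> aq Av z tS tw; have [cq dq] := aq.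
have vt : vertical s q (vparam c q t).
  by apply/(verticalE _ aq); rewrite (vparamK _ cq).
have t0 : vparam c q t = 0.
  apply: (hnd Av vt) => w /(verticalE _ aq) vw.
  by rewrite (fundamentalE _ _ cq Av) (vparamK _ cq) (tw _ vw) mxE.
by rewrite -[t](vparamK _ cq) t0 vcoord0.
Qed.

Lemma smooth_vpart_mx : smooth_on adapted_tchart vpart_mx.
Proof.
have oO := adapted_tchart_open.
have sG : smooth_on adapted_tchart metric_mx.
  by apply: smooth_on_sub smooth_metric_mx => z [].
have sS : smooth_on adapted_tchart (sub_mx \o fst).
  apply: smooth_comp smooth_sub_mx _ => //; first exact: has_frame_rV.
  - exact: adapted_image_open.
  - by move=> z [].
  - exact: smooth_fst.
have s0 n : smooth_on adapted_tchart
    (fun=> 0 : 'M[R]_(n, dim B)) := @smooth_cst _ _ _ _ _.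
have sK : smooth_on adapted_tchart
    (fun z => proj_system (metric_mx z) (sub_mx z.1)).
  apply: smooth_col_mx => //; apply: smooth_row_mx => //.
  exact: smooth_trmx.
have sR := smooth_row_mx oO sG (s0 _).
have sKi : smooth_on adapted_tchart
    (fun z => invmx (proj_system (metric_mx z) (sub_mx z.1))).
  apply: smooth_invmx => // z /adapted_tchartP[q [v [aq Av ->]]].
  apply: proj_system_unit; first by move=> f; exact: sub_mx_surj.
  by move=> t; exact: metric_mx_nondegenerate.
exact: (smooth_lsubmx oO (smooth_mulmx oO sR sKi)).
Qed.

Lemma ghorizontalE q v e : adapted q -> A q v -> ghorizontal s L q v e <->
  forall w : N, w *m sub_mx (coord c q) = 0 ->
    vcoord c q e *m metric_mx (coord c q, vcoord c q v) *m w^T = 0.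
Proof.
move=> aq Av; have [cq dq] := aq; split=> [he w wS|he w vw].
  have := he (vparam c q w).
  rewrite (fundamentalE _ _ cq Av) (vparamK _ cq) => he'.
  apply/matrixP => i j; rewrite !ord1 [RHS]mxE he'//.
  by apply/(verticalE _ aq); rewrite (vparamK _ cq).
by rewrite (fundamentalE _ _ cq Av) he ?mxE//; exact/(verticalE _ aq).
Qed.

Lemma vpart_uniq q v e t : adapted q -> A q v -> vertical s q t ->
  ghorizontal s L q v (e - t) ->
  vcoord c q e *m vpart_mx (coord c q, vcoord c q v) = vcoord c q t.
Proof.
move=> aq Av /(verticalE _ aq) vt /(ghorizontalE _ aq Av) ht; have [cq dq] := aq.
apply: kerproj_uniq => //; first by move=> f; exact: sub_mx_surj.
  by move=> t'; exact: metric_mx_nondegenerate.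
by rewrite vcoordB// in ht.
Qed.

Lemma vpart_exists q v e : adapted q -> A q v ->
  exists t, vertical s q t /\ ghorizontal s L q v (e - t).
Proof.
move=> aq Av; have [cq dq] := aq; set z := (coord c q, vcoord c q v).
have [S0 G0] := @kerprojP _ _ _ (metric_mx z) (sub_mx z.1)
  (fun f => sub_mx_surj f aq) (fun t => @metric_mx_nondegenerate q v t aq Av)
  (vcoord c q e).
exists (vparam c q (vcoord c q e *m vpart_mx z)); split.
  by apply/(verticalE _ aq); rewrite (vparamK _ cq).
by apply/(ghorizontalE _ aq Av); rewrite (vcoordB _ _ cq) (vparamK _ cq).
Qed.

Lemma vpartP q v e : adapted q -> A q v ->
  vertical s q (vpart s L q v e) /\ ghorizontal s L q v (e - vpart s L q v e).
Proof. by move=> aq Av; exact: (xgetPex 0 (vpart_exists e aq Av)). Qed.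

(** [vpart] picks some decomposition at each point; uniqueness identifies the choice with [kerproj],
    and the smooth matrix family [vpart_mx] can replace it from here on. *)
Lemma vcoord_vpart q v e : adapted q -> A q v ->
  vcoord c q (vpart s L q v e) =
  vcoord c q e *m vpart_mx (coord c q, vcoord c q v).
Proof.
move=> aq Av; have [vt ht] := vpartP e aq Av.
by rewrite (vpart_uniq aq Av vt ht).
Qed.

Lemma vpart_vertical q v e : adapted q -> A q v -> vertical s q e ->
  vcoord c q e *m vpart_mx (coord c q, vcoord c q v) = vcoord c q e.
Proof.
move=> aq Av ve; apply: (vpart_uniq aq Av ve); apply/(ghorizontalE _ aq Av) => w _.
by rewrite subrr vcoord0 ?mul0mx//; case: aq.
Qed.

Lemma vpart_ghorizontal q v e : adapted q -> A q v -> ghorizontal s L q v e ->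
  vcoord c q e *m vpart_mx (coord c q, vcoord c q v) = 0.
Proof.
move=> aq Av he; have [cq _] := aq.
have v0 : vertical s q 0.
  by apply/(verticalE _ aq); rewrite (vcoord0 cq) mul0mx.
by rewrite (vpart_uniq aq Av v0) ?subr0// (vcoord0 cq).
Qed.

Lemma vpart_mx_idem z : adapted_tchart z -> vpart_mx z *m vpart_mx z = vpart_mx z.
Proof.
move=> /adapted_tchartP[q [v [aq Av ->]]]; have [cq _] := aq.
apply/row_matrixP => a; rewrite row_mul rowE.
set e := vparam c q (delta_mx 0 a).
have <- : vcoord c q e = delta_mx 0 a := vparamK _ cq.
rewrite -(vcoord_vpart e aq Av).
by apply: (vpart_vertical aq Av); have [] := vpartP e aq Av.
Qed.

End Submersion.

(** * Off-diagonal matrices *)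

Lemma addmxE (R : pzRingType) m k (X Y : 'M[R]_(m, k)) i j : (X + Y) i j = X i j + Y i j.
Proof. by rewrite mxE. Qed.

Lemma oppmxE (R : pzRingType) m k (X : 'M[R]_(m, k)) i j : (- X) i j = - X i j.
Proof. by rewrite mxE. Qed.

Lemma zeromxE (R : pzRingType) m k i j : (0 : 'M[R]_(m, k)) i j = 0.
Proof. by rewrite mxE. Qed.

Lemma scalemxE (R : pzRingType) m k a (X : 'M[R]_(m, k)) i j : (a *: X) i j = a * X i j.
Proof. by rewrite mxE. Qed.

(* Noncommutative monomials become atoms of the commutative ring tactic once
   entries are taken. *)
Ltac mxexpand := rewrite ?(mulmxDl, mulmxDr, mulmxBl, mulmxBr, mulNmx, mulmxN,
  mul1mx, mulmx1, mulmxA, mul0mx, mulmx0).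
Ltac mxring := mxexpand;
  apply/matrixP => ? ?; rewrite !(addmxE, oppmxE, zeromxE); ring.

Section OffDiagonal.
Variables (R : comNzRingType) (n : nat).
Implicit Types P D G S X : 'M[R]_n.

(** Compressing the relation by P on both sides gives PSP = PSP + PSP. *)
Lemma offdiagP P S : P *m P = P -> S = S *m P + P *m S -> P *m S *m P = 0.
Proof.
move=> PP SE; apply: (@addIr _ (P *m S *m P)); rewrite add0r.
by rewrite [in RHS]SE mulmxDr mulmxDl !mulmxA PP -[_ *m P *m P]mulmxA PP.
Qed.

(* The O'Neill tensor of a connection for which the covariant derivative of
   the projection P is D + P *m G - G *m P. *)
Definition offdiag_chi P D G : 'M[R]_n :=
  (- D + (1%:M - P) *m G) *m P + (D + P *m G) *m (1%:M - P).

(** Here [f] is a row vector and [a] the derivative of an extension of it. Idempotence annihilates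
    both occurrences of [a], which is the tensoriality of chi. *)
Lemma offdiag_chi_row P D G (a f : 'rV[R]_n) : P *m P = P ->
  (a - (a *m P + f *m D) + (f - f *m P) *m G) *m P
  + (a *m P + f *m D + f *m P *m G) *m (1%:M - P) = f *m offdiag_chi P D G.
Proof.
move=> PP; have KP (X : 'rV[R]_n) : X *m P *m P = X *m P by rewrite -mulmxA PP.
by rewrite /offdiag_chi; mxexpand; rewrite !KP; mxring.
Qed.

Lemma offdiag_chiE P D G : P *m P = P -> D = D *m P + P *m D ->
  offdiag_chi P D G =
  P *m D - D *m P + G *m P + P *m G - P *m G *m P - P *m G *m P.
Proof.
move=> PP DE; have PD : P *m D = D - D *m P by rewrite {2}DE addrAC subrr add0r.
by rewrite /offdiag_chi PD; mxring.
Qed.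

Lemma offdiag_chi_off P D G : P *m P = P -> D = D *m P + P *m D ->
  offdiag_chi P D G = offdiag_chi P D G *m P + P *m offdiag_chi P D G.
Proof.
move=> PP DE; have PDP := offdiagP PP DE.
rewrite offdiag_chiE//; mxexpand.
have KP X : X *m P *m P = X *m P by rewrite -mulmxA PP.
by rewrite !KP !PP !PDP; mxring.
Qed.

(** chi treats vertical and horizontal alike: exchanging P with its complement changes the sign of
    the derivative of P and leaves chi unchanged. *)
Lemma offdiag_chi_compl P D G : P *m P = P -> D = D *m P + P *m D ->
  offdiag_chi (1%:M - P) (- D) G = offdiag_chi P D G.
Proof. by move=> PP DE; rewrite /offdiag_chi; mxring. Qed.

Lemma offdiag_chi_linear P a D D' G G' :
  offdiag_chi P (a *: D + D') (a *: G + G') =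
  a *: offdiag_chi P D G + offdiag_chi P D' G'.
Proof.
rewrite /offdiag_chi; mxexpand.
apply/matrixP => i j; rewrite -!scalemxAr -!scalemxAl.
by rewrite !(addmxE, oppmxE, scalemxE); ring.
Qed.

(** The left factor is the covariant derivative of S = S_b, where [S'] is the correction for the
    slot b. Since [S'] is off-diagonal too, it disappears under compression; the terms in [G] on the
    left match those contained in [X]. *)
Lemma offdiag_exchange P D G S DS S' : P *m P = P ->
  D = D *m P + P *m D -> S = S *m P + P *m S -> S' = S' *m P + P *m S' ->
  DS = DS *m P + S *m D + (D *m S + P *m DS) ->
  let X := offdiag_chi P D G in
  P *m (DS + S *m G - S' - G *m S) *m P = P *m (S *m X - X *m S).
Proof.
move=> PP DE SE S'E DSE X; have PDP := offdiagP PP DE.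
have PSP := offdiagP PP SE; have PS'P := offdiagP PP S'E.
have KP Y : Y *m P *m P = Y *m P by rewrite -mulmxA PP.
(* Compressing the differentiated relation produces P DS P twice on the right, so one copy cancels
   and the other is determined with a minus sign. *)
have PDS : P *m DS *m P = - (P *m S *m D *m P) - P *m D *m S *m P.
  apply: (@addIr _ (P *m DS *m P)).
  by rewrite [in X in _ = _ + X]DSE; mxexpand; rewrite !KP PP; mxring.
have PDSP : P *m D *m S = P *m D *m S *m P.
  by rewrite {1}SE mulmxDr !mulmxA PDP mul0mx addr0.
have PGSP : P *m G *m S = P *m G *m S *m P + P *m G *m P *m S.
  by rewrite {1}SE mulmxDr !mulmxA.
rewrite /X offdiag_chiE//; mxexpand.
rewrite PSP PP PDP [in RHS]PDSP [in RHS]PGSP PDS PS'P !mul0mx.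
by mxring.
Qed.

(** All hypotheses, and [X] itself, survive replacing P and D by 1 - P and - D, so the horizontal
    block is the vertical block of the complementary projection. *)
Lemma offdiag_exchange_compl P D G S DS S' : P *m P = P ->
  D = D *m P + P *m D -> S = S *m P + P *m S -> S' = S' *m P + P *m S' ->
  DS = DS *m P + S *m D + (D *m S + P *m DS) ->
  let X := offdiag_chi P D G in let Q := 1%:M - P in
  Q *m (DS + S *m G - S' - G *m S) *m Q = Q *m (S *m X - X *m S).
Proof.
move=> PP DE SE S'E DSE X Q.
have off Y : Y = Y *m P + P *m Y -> P *m Y = Y - Y *m P.
  by move=> YE; rewrite {2}YE addrAC subrr add0r.
rewrite /X -(offdiag_chi_compl G PP DE); apply: offdiag_exchange.
- by rewrite mulmxBl mul1mx mulmxBr mulmx1 PP subrr subr0.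
- by have PD := off _ DE; mxexpand; rewrite PD; mxring.
- by have PS := off _ SE; rewrite /Q; mxexpand; rewrite PS; mxring.
- by have PS' := off _ S'E; rewrite /Q; mxexpand; rewrite PS'; mxring.
- have PDS : P *m DS = DS - DS *m P - S *m D - D *m S.
    by rewrite [in X in X - _ - _ - _]DSE; mxring.
  by rewrite /Q; mxexpand; rewrite PDS; mxring.
Qed.

Lemma mulmx_covD (e : 'rV[R]_n) (DS S S' G : 'M[R]_n) :
  e *m DS + e *m S *m G - e *m S' - e *m G *m S =
  e *m (DS + S *m G - S' - G *m S).
Proof. by rewrite !mulmxBr mulmxDr !mulmxA. Qed.

End OffDiagonal.

(** * The O'Neill tensors *)

Section ONeill.
Variables (R : realType) (M B : manifold R) (s : M -> B) (A : tset M)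
  (L : afun M) (A' : tset B) (L' : afun B) (nabla : connection M).
Hypothesis hL : pseudo_finsler A L.
Hypothesis hs : pseudo_finsler_submersion s A L A' L'.
Hypothesis hnd : vertical_nondegenerate s A L.
Hypothesis hn : anisotropic_connection A nabla.
Variables (c : chart M) (d : chart B).
Local Notation N := 'rV[R]_(dim M).
Implicit Types (q p : M) (v e h b u : 'T[R]_M) (z : (N * N)%type).

Local Notation adapt := (adapted s c d).
Local Notation O := (adapted_tchart s A c d).
Local Notation P := (vpart_mx s L c d).
Local Notation G := (conn_mx nabla c).
Local Notation Q := (fun z => 1%:M - P z).

(* The horizontal lift of h at z for the nonlinear connection of nabla. *)
Definition hlift z (h : N) : (N * N)%type := (h, - (z.2 *m G z h)).

Definition vpart_der z (h : N) : 'M[R]_(dim M) := 'D_(hlift z h) P z.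

Definition chi_mx z (h : N) : 'M[R]_(dim M) :=
  offdiag_chi (P z) (vpart_der z h) (G z h).

Let oO : open O.
Proof. by move: (adapted_tchart_open hL hs (c := c) (d := d)); exact. Qed.

Let sP : smooth_on O P := smooth_vpart_mx hL hs hnd c d.

Let dP z : O z -> differentiable P z.
Proof. by move=> Oz; exact: (smooth_differentiable sP Oz). Qed.

Let idP z : O z -> P z *m P z = P z.
Proof. by move=> Oz; exact: (vpart_mx_idem hL hs hnd Oz). Qed.

Lemma conn_mx_linear z : linear (G z).
Proof.
move=> a h h'; rewrite /conn_mx scaler_sumr -big_split.
by apply: eq_bigr => i _; rewrite !mxE scalerDl scalerA.
Qed.

Lemma smooth_conn_mx h : smooth_on O (fun z => G z h).
Proof.
have oA : open (tchart A c) by move: (tchart_open hL (c := c)); exact.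
apply: (smooth_sum _ _ oO) => a; apply: (smoothZ oO (smooth_cst _ _)).
by apply: smooth_on_sub (smooth_christoffel hn a oA) => z [].
Qed.

Lemma hlift_linear z : linear (hlift z).
Proof.
move=> a h h'; congr pair; rewrite /= conn_mx_linear mulmxDr opprD.
by rewrite -scalemxAr scalerN.
Qed.

Lemma vpart_der_linear z : O z -> linear (vpart_der z).
Proof.
move=> Oz a h h'; have dPz := dP Oz.
by rewrite /vpart_der hlift_linear (derive_dirD _ _ dPz) (derive_dirZ _ _ dPz).
Qed.

(** The direction [hlift z h] moves with [z]. Splitting it into fixed directions with variable
    coefficients lets smoothness of iterated derivatives apply. *)
Lemma derive_hlift (m n : nat) (F : (N * N)%type -> 'M[R]_(m, n)) z h :
  differentiable F z -> 'D_(hlift z h) F z =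
  'D_(h, 0) F z - \sum_a (z.2 *m G z h) 0 a *: 'D_(0, delta_mx 0 a) F z.
Proof.
move=> dF; have -> : hlift z h = (h, 0) + (-1) *: (0, z.2 *m G z h) :> N * N.
  by congr pair; rewrite /= ?scaler0 ?addr0// add0r scaleN1r.
rewrite (derive_dirD _ _ dF) (derive_dirZ _ _ dF) scaleN1r pair0_sum.
rewrite derive_dir_sum//; congr (_ - _); apply: eq_bigr => a _.
exact: derive_dirZ.
Qed.

Lemma smooth_vpart_der h : smooth_on O (fun z => vpart_der z h).
Proof.
have sy : smooth_on O (fun z => z.2 *m G z h).
  by apply: smooth_mulmx => //; [exact: smooth_snd|exact: smooth_conn_mx].
have sya := (smooth_mxP _ oO).1 sy 0.
have : smooth_on O (fun z => 'D_(h, 0) P z -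
    \sum_a (z.2 *m G z h) 0 a *: 'D_(0, delta_mx 0 a) P z).
  apply: smoothB => //; first exact: smooth_derive.
  apply: smooth_sum => // a; apply: smoothZ => //; exact: smooth_derive.
apply: smooth_on_eq => // z Oz.
by rewrite /vpart_der derive_hlift//; exact: dP.
Qed.

Lemma smooth_chi_mx h : smooth_on O (fun z => chi_mx z h).
Proof.
have sG := smooth_conn_mx h; have sD := smooth_vpart_der h.
have sQ : smooth_on O Q by apply: smoothB => //; exact: smooth_cst.
apply: smoothD => //; apply: smooth_mulmx => //.
  apply: smoothD => //; [exact: smoothN|exact: smooth_mulmx].
by apply: smoothD => //; exact: smooth_mulmx.
Qed.

Lemma chi_mx_linear z : O z -> linear (chi_mx z).
Proof.
move=> Oz a h h'.
by rewrite /chi_mx (vpart_der_linear Oz) conn_mx_linear offdiag_chi_linear.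
Qed.

(** In T_b and A_b the direction handed to chi is a projection of b and so depends on the point;
    linearity reduces this to finitely many fixed directions. *)
Lemma smooth_chi_mx_lin b (F : (N * N)%type -> 'M[R]_(dim M)) :
  smooth_on O F -> smooth_on O (fun z => chi_mx z (b *m F z)).
Proof.
move=> sF; have sb : smooth_on O (fun z => b *m F z).
  by apply: smooth_mulmx => //; exact: smooth_cst.
have sba := (smooth_mxP _ oO).1 sb 0.
have : smooth_on O
    (fun z => \sum_a (b *m F z) 0 a *: chi_mx z (delta_mx 0 a)).
  by apply: smooth_sum => // a; apply: smoothZ => //; exact: smooth_chi_mx.
apply: smooth_on_eq => // z Oz.
have [l El] := linear_pack (chi_mx_linear Oz).
rewrite [in RHS](row_sum_delta (b *m F z)) El linear_sum.
by apply: eq_bigr => a _; rewrite linearZ.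
Qed.

Lemma vpart_der_off z h : O z ->
  vpart_der z h = vpart_der z h *m P z + P z *m vpart_der z h.
Proof.
move=> Oz; rewrite -(derive_mulmx _ (dP Oz) (dP Oz)).
apply: near_eq_derive.
have : \forall z \near z, O z by exact: open_nbhs_nbhs.
by apply: filterS => z' Oz'; rewrite idP.
Qed.

Lemma chi_mx_off z h : O z -> chi_mx z h = chi_mx z h *m P z + P z *m chi_mx z h.
Proof. by move=> Oz; exact/offdiag_chi_off/vpart_der_off/Oz/idP. Qed.

Lemma vcoord_hpart q v e : adapt q -> A q v ->
  vcoord c q (hpart s L q v e) =
  vcoord c q e *m (1%:M - P (coord c q, vcoord c q v)).
Proof.
move=> aq Av; have [cq _] := aq.
by rewrite (vcoordB _ _ cq) (vcoord_vpart hL hs hnd _ aq Av) mulmxBr mulmx1.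
Qed.

Lemma adapted_tchart_inv q v : dom c q -> O (coord c q, vcoord c q v) ->
  adapt q /\ A q v.
Proof.
move=> cq [[_ /=]]; rewrite (coordK cq) (vcoordK _ cq) => Av.
move=> [q' aq' /(congr1 (param c))] /=.
by rewrite (coordK cq) (coordK aq'.1) => eqq; split; rewrite // -eqq.
Qed.

(** This must hold at every adapted q, because T and A are differentiated in q afterwards. The
    preferred chart of q may differ from [c], so the extension of [e] is not constant in [c] and is
    smooth only over [O0]; its derivative drops out by [offdiag_chi_row]. *)
Lemma vcoord_chi q v h e : adapt q -> A q v ->
  vcoord c q (oneill_chi s L nabla q v h e) =
  vcoord c q e *m chi_mx (coord c q, vcoord c q v) (vcoord c q h).
Proof.
move=> aq Av; have [cq dq] := aq.
set z := (coord c q, vcoord c q v); set h' := vcoord c q h.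
have Oz : O z := adapted_tchartE aq Av.
pose O0 := coord c @` (dom (chart_at q) `&` dom c).
have oO0 : open O0 := chart_image_open (i := c) (dom_open (chart_at q)).
have O0q : O0 (coord c q) by exists q => //; split => //; exact: dom_chart_at.
pose E := vrep c (ext q e).
have sE : smooth_on O0 E := smooth_vrep_ext c q e.
pose O1 := O `&` fst @^-1` O0.
have oO1 : open O1.
  apply: openI => //.
  have /continuousP : continuous (@fst N N) by move=> x; exact: cvg_fst.
  exact.
have O1z : O1 z by split.
have sE1 : smooth_on O1 (E \o fst).
  apply: (smooth_comp (has_frame_rV R (dim M)) oO1 oO0 _ sE).
    by move=> ? [].
  exact: smooth_fst.
have sP1 : smooth_on O1 P by apply: smooth_on_sub sP => ? [].
have sv : smooth_on O1 (fun z => E z.1 *m P z) by exact: smooth_mulmx.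
have sh : smooth_on O1 (fun z => E z.1 - E z.1 *m P z) by exact: smoothB.
have vE q' v' : dom c q' -> O1 (coord c q', vcoord c q' v') ->
    vcoord c q' (vpart s L q' v' (ext q e q')) =
    E (coord c q') *m P (coord c q', vcoord c q' v').
  move=> cq' [/(adapted_tchart_inv cq')[aq' Av'] _].
  by rewrite (vcoord_vpart hL hs hnd _ aq' Av') /E (vrepE _ cq').
have hE q' v' : dom c q' -> O1 (coord c q', vcoord c q' v') ->
    vcoord c q' (hpart s L q' v' (ext q e q')) =
    E (coord c q') - E (coord c q') *m P (coord c q', vcoord c q' v').
  move=> cq' O1q'; rewrite /hpart (vcoordB _ _ cq') (vE _ _ cq' O1q').
  by rewrite /E (vrepE _ cq').
have covv := cov_fieldE hn h cq Av oO1 O1z sv vE.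
have covh := cov_fieldE hn h cq Av oO1 O1z sh hE.
have Eq : E (coord c q) = vcoord c q e by rewrite /E (vrepE _ cq) ext_id.
rewrite /oneill_chi (vcoordD _ _ cq) (vcoord_vpart hL hs hnd _ aq Av).
rewrite (vcoord_hpart _ aq Av) covv covh -/z -/h' -/(hlift z h').
have dE : differentiable (E \o fst) z := smooth_differentiable sE1 O1z.
have dPz := dP Oz.
have dEP := smooth_differentiable sv O1z.
have -> : 'D_(hlift z h') (fun z => E z.1 - E z.1 *m P z) z =
    'D_(hlift z h') (E \o fst) z - 'D_(hlift z h') (fun z => E z.1 *m P z) z.
  by rewrite -deriveB//; exact: diff_derivable.
rewrite (derive_mulmx (F := E \o fst) _ dE dPz) -/(vpart_der z h').
set a := 'D_(hlift z h') (E \o fst) z; set D := vpart_der z h'.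
rewrite /comp -[z.1]/(coord c q) Eq; set f := vcoord c q e.
exact: (offdiag_chi_row _ _ _ _ (idP Oz)).
Qed.

(* S' b z is the matrix of e |-> S^v_b e, acting on row vectors. *)
Definition represents (S : atensor M) (S' : N -> (N * N)%type -> 'M[R]_(dim M)) :=
  forall q v b e, adapt q -> A q v -> vcoord c q (S q v b e) =
  vcoord c q e *m S' (vcoord c q b) (coord c q, vcoord c q v).

Lemma vcoord_ext p q e : chart_at p = c -> dom c q ->
  vcoord c q (ext p e q) = vcoord c p e.
Proof. by move=> <- cq; rewrite /ext (vparamK _ cq) vcoord_chart_at. Qed.

(** When [c] is the preferred chart of p, the extensions of [b] and [e] are constant in [c]. Their
    covariant derivatives then reduce to multiplication by the connection matrix, which yields the
    two subtracted terms. *)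
Lemma vcoord_cov_tensor (S : atensor M) S' p v w b e : chart_at p = c ->
  adapt p -> A p v -> represents S S' -> (forall b, smooth_on O (S' b)) ->
  let z := (coord c p, vcoord c p v) in let b' := vcoord c p b in
  let g := G z (vcoord c p w) in
  vcoord c p (cov_tensor nabla S p v w b e) = vcoord c p e *m
  ('D_(hlift z (vcoord c p w)) (S' b') z + S' b' z *m g
     - S' (b' *m g) z - g *m S' b' z).
Proof.
move=> pc ap Av rS sS z b' g; have [cp _] := ap.
have Oz : O z := adapted_tchartE ap Av.
have sX : smooth_on O (fun z => vcoord c p e *m S' b' z).
  by apply: smooth_mulmx => //; exact: smooth_cst.
have XE q' v' : dom c q' -> O (coord c q', vcoord c q' v') ->
    vcoord c q' (S q' v' (ext p b q') (ext p e q')) =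
    vcoord c p e *m S' b' (coord c q', vcoord c q' v').
  move=> cq' /(adapted_tchart_inv cq')[aq' Av'].
  by rewrite (rS _ _ _ _ aq' Av') !(vcoord_ext _ pc cq').
have covX := cov_fieldE hn w cp Av oO Oz sX XE.
have nabE x : vcoord c p (nabla_at nabla (ext p x) p v w) = vcoord c p x *m g.
  have sx := @smooth_cst _ N N [set: N] (vcoord c p x).
  have Ex : \forall q' \near p, vcoord c q' (ext p x q') =
      cst (vcoord c p x) (coord c q').
    by apply: filterS (near_dom cp) => q' cq'; rewrite (vcoord_ext _ pc cq').
  have := nabla_atE hn w cp Av (@openT _) I sx Ex.
  by rewrite derive_cst add0r.
rewrite /cov_tensor 2!(vcoordB _ _ cp) covX !(rS _ _ _ _ ap Av) !nabE -/z -/g -/b'.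
have dS := smooth_differentiable (sS b') Oz.
rewrite (derive_mulmx _ (differentiable_cst (vcoord c p e) z) dS) derive_cst.
by rewrite mul0mx add0r; exact: mulmx_covD.
Qed.

Lemma derive_off (S' : (N * N)%type -> 'M[R]_(dim M)) z h : smooth_on O S' ->
  (forall z, O z -> S' z = S' z *m P z + P z *m S' z) -> O z ->
  let DS := 'D_(hlift z h) S' z in let D := vpart_der z h in
  DS = DS *m P z + S' z *m D + (D *m S' z + P z *m DS).
Proof.
move=> sS SE Oz DS D.
have dS := smooth_differentiable sS Oz; have dPz := dP Oz.
rewrite -(derive_mulmx _ dS dPz) -(derive_mulmx _ dPz dS).
have dSP := smooth_differentiable (smooth_mulmx oO sS sP) Oz.
have dPS := smooth_differentiable (smooth_mulmx oO sP sS) Oz.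
rewrite -(deriveD (diff_derivable dSP) (diff_derivable dPS)).
apply: near_eq_derive.
have : \forall z \near z, O z by exact: (open_nbhs_nbhs (conj oO Oz)).
by apply: filterS => z' Oz'; exact: SE.
Qed.

Lemma cov_tensor_exchange (S : atensor M) S' p v w b e : chart_at p = c ->
  adapt p -> A p v -> represents S S' -> (forall b, smooth_on O (S' b)) ->
  (forall b z, O z -> S' b z = S' b z *m P z + P z *m S' b z) ->
  let chi := oneill_chi s L nabla p v in
  let C := chi w (S p v b e) - S p v b (chi w e) in
  (vertical s p e -> vpart s L p v (cov_tensor nabla S p v w b e) = C) /\
  (ghorizontal s L p v e -> hpart s L p v (cov_tensor nabla S p v w b e) = C).
Proof.
move=> pc ap Av rS sS SE chi C; have [cp _] := ap.
pose z := (coord c p, vcoord c p v).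
have Oz : O z := adapted_tchartE ap Av.
have covE := vcoord_cov_tensor w b e pc ap Av rS sS.
have CE : vcoord c p C = vcoord c p e *m
    (S' (vcoord c p b) z *m chi_mx z (vcoord c p w) -
     chi_mx z (vcoord c p w) *m S' (vcoord c p b) z).
  rewrite /C (vcoordB _ _ cp) (vcoord_chi _ _ ap Av) !(rS _ _ _ _ ap Av).
  by rewrite (vcoord_chi _ _ ap Av) mulmxBr !mulmxA.
have DSE := derive_off (vcoord c p w) (sS (vcoord c p b)) (SE _) Oz.
have DE := vpart_der_off (vcoord c p w) Oz.
split=> [ve|he]; apply: (vcoord_inj cp); rewrite CE.
  rewrite (vcoord_vpart hL hs hnd _ ap Av) covE.
  (* A vertical [e] is fixed by P; writing it as e P supplies the left factor P of the compressed
     identity. *)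
  rewrite -(vpart_vertical hL hs hnd ap Av ve) -/z -!mulmxA; congr (_ *m _).
  by rewrite mulmxA; exact: (offdiag_exchange _ (idP Oz) DE (SE _ _ Oz) (SE _ _ Oz) DSE).
rewrite (vcoord_hpart _ ap Av) covE.
(* Likewise a horizontal [e] is fixed by the complementary projection, which supplies the left
   factor. *)
have -> : vcoord c p e = vcoord c p e *m (1%:M - P z).
  by rewrite mulmxBr mulmx1 (vpart_ghorizontal hL hs hnd ap Av he) subr0.
rewrite -/z -!mulmxA; congr (_ *m _); rewrite mulmxA.
exact: (offdiag_exchange_compl _ (idP Oz) DE (SE _ _ Oz) (SE _ _ Oz) DSE).
Qed.

(** T_b, A_b and (T + A)_b are all chi in the direction b F, with F equal to P, 1 - P and 1
    respectively, so one argument treats the three tensors. *)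
Lemma cov_chi_exchange (S : atensor M) (F : (N * N)%type -> 'M[R]_(dim M))
    p v w b e : chart_at p = c -> adapt p -> A p v -> smooth_on O F ->
  represents S (fun b z => chi_mx z (b *m F z)) ->
  let chi := oneill_chi s L nabla p v in
  let C := chi w (S p v b e) - S p v b (chi w e) in
  (vertical s p e -> vpart s L p v (cov_tensor nabla S p v w b e) = C) /\
  (ghorizontal s L p v e -> hpart s L p v (cov_tensor nabla S p v w b e) = C).
Proof.
move=> pc ap Av sF rS; apply: (cov_tensor_exchange w b e pc ap Av rS).
  by move=> b'; exact: smooth_chi_mx_lin.
by move=> b' z Oz; exact: chi_mx_off.
Qed.

Lemma represents_T :
  represents (oneill_T s L nabla) (fun b z => chi_mx z (b *m P z)).
Proof.
move=> q v b e aq Av.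
by rewrite (vcoord_chi _ _ aq Av) (vcoord_vpart hL hs hnd _ aq Av).
Qed.

Lemma represents_A :
  represents (oneill_A s L nabla) (fun b z => chi_mx z (b *m (1%:M - P z))).
Proof.
by move=> q v b e aq Av; rewrite (vcoord_chi _ _ aq Av) (vcoord_hpart _ aq Av).
Qed.

(** The vertical and horizontal parts of [b] add up to [b]; the additivity of chi in its direction
    is read off its matrix. *)
Lemma oneill_TAE p v b e : adapt p -> A p v ->
  oneill_TA s L nabla p v b e = oneill_chi s L nabla p v b e.
Proof.
move=> ap Av; have [cp _] := ap; apply: (vcoord_inj cp).
have Oz := adapted_tchartE ap Av.
rewrite /oneill_TA (vcoordD _ _ cp).
apply: etrans (congr2 +%R (represents_T b e ap Av)
  (represents_A b e ap Av)) _.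
apply: etrans (esym (vcoord_chi b e ap Av)).
rewrite -mulmxDr; congr (_ *m _).
have [l El] := linear_pack (chi_mx_linear Oz).
by rewrite El -linearD -mulmxDr addrC subrK mulmx1.
Qed.

Lemma represents_TA :
  represents (oneill_TA s L nabla) (fun b z => chi_mx z (b *m 1%:M)).
Proof.
by move=> q v b e aq Av; rewrite oneill_TAE// (vcoord_chi _ _ aq Av) mulmx1.
Qed.

Lemma oneill_T_vertical p v w e : adapt p -> A p v -> vertical s p w ->
  oneill_T s L nabla p v w e = oneill_chi s L nabla p v w e.
Proof.
move=> ap Av vw; rewrite /oneill_T; congr (oneill_chi s L nabla p v _ e).
apply: (vcoord_inj ap.1); rewrite (vcoord_vpart hL hs hnd _ ap Av).
exact: (vpart_vertical hL hs hnd ap Av vw).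
Qed.

Lemma oneill_A_ghorizontal p v x e : adapt p -> A p v -> ghorizontal s L p v x ->
  oneill_A s L nabla p v x e = oneill_chi s L nabla p v x e.
Proof.
move=> ap Av hx; rewrite /oneill_A; congr (oneill_chi s L nabla p v _ e).
apply: (vcoord_inj ap.1); rewrite (vcoord_hpart _ ap Av) mulmxBr mulmx1.
by rewrite (vpart_ghorizontal hL hs hnd ap Av hx) subr0.
Qed.

Let smooth_F : [/\ smooth_on O P, smooth_on O Q &
  smooth_on O (fun=> 1%:M : 'M[R]_(dim M))].
Proof.
have s1 := @smooth_cst _ (N * N)%type 'M[R]_(dim M) O 1%:M.
by split=> //; exact: smoothB.
Qed.

Lemma cov_oneill_exchange p v w b e : chart_at p = c -> adapt p -> A p v ->
  let chi := oneill_chi s L nabla p v in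
  let C S := chi w (S p v b e) - S p v b (chi w e) in
  forall S : atensor M,
  [\/ S = oneill_T s L nabla, S = oneill_A s L nabla |
      S = oneill_TA s L nabla] ->
  (vertical s p e -> vpart s L p v (cov_tensor nabla S p v w b e) = C S) /\
  (ghorizontal s L p v e -> hpart s L p v (cov_tensor nabla S p v w b e) = C S).
Proof.
move=> pc ap Av chi C S; have [sp sq s1] := smooth_F.
case=> ->.
- exact: (cov_chi_exchange _ _ _ pc ap Av sp represents_T).
- exact: (cov_chi_exchange _ _ _ pc ap Av sq represents_A).
- exact: (cov_chi_exchange _ _ _ pc ap Av s1 represents_TA).
Qed.

End ONeill.

Theorem lemma8 (R : realType) (M B : manifold R) (s : M -> B)
    (A : tset M) (L : afun M) (A' : tset B) (L' : afun B)
    (nabla : connection M)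
    (hL : pseudo_finsler A L) (hL' : pseudo_finsler A' L')
    (hs : pseudo_finsler_submersion s A L A' L')
    (hnd : vertical_nondegenerate s A L)
    (hnabla : levi_civita_chern A L nabla)
    (p : M) (v : 'T[R]_M) (hv : A p v)
    (u w x e h : 'T[R]_M)
    (hu : vertical s p u) (hw : vertical s p w)
    (hx : ghorizontal s L p v x) :
  let top := vpart s L p v in
  let bot := hpart s L p v in
  let OT := oneill_T s L nabla in
  let OA := oneill_A s L nabla in
  let TA := oneill_TA s L nabla in
  let D := cov_tensor nabla in
  let Tv := OT p v in
  let Av := OA p v in
  let TAv := TA p v in
  [/\ top (D OA p v w e u) = Tv w (Av e u) - Av e (Tv w u),
      top (D OA p v x e u) = Av x (Av e u) - Av e (Av x u),
      top (D OT p v w e u) = Tv w (Tv e u) - Tv e (Tv w u) &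
      top (D OT p v x e u) = Av x (Tv e u) - Tv e (Av x u)]
  /\ (forall y : 'T[R]_M, ghorizontal s L p v y ->
      [/\ bot (D OA p v w e y) = Tv w (Av e y) - Av e (Tv w y),
          bot (D OA p v x e y) = Av x (Av e y) - Av e (Av x y),
          bot (D OT p v w e y) = Tv w (Tv e y) - Tv e (Tv w y) &
          bot (D OT p v x e y) = Av x (Tv e y) - Tv e (Av x y)])
  /\ top (D TA p v e h u) = TAv e (TAv h u) - TAv h (TAv e u)
  /\ (forall y : 'T[R]_M, ghorizontal s L p v y ->
      bot (D TA p v e h y) = TAv e (TAv h y) - TAv h (TAv e y)).
Proof.
have hn := lcc_connection hnabla.
(* The preferred charts of p and s p are taken for [c] and [d], so that the fields [ext p] have
   constant components in [c]. *)
have ap : adapted s (chart_at p) (chart_at (s p)) p.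
  by split; exact: dom_chart_at.
move=> top bot OT OA TA D Tv Av TAv.
pose chi := oneill_chi s L nabla p v.
have TwE f : Tv w f = chi w f := oneill_T_vertical nabla hL hs hnd f ap hv hw.
have AxE f : Av x f = chi x f := oneill_A_ghorizontal nabla hL hs hnd f ap hv hx.
have TAeE f : TAv e f = chi e f := oneill_TAE hL hs hnd hn e f ap hv.
(* [X] stands for T_w, A_x or (T + A)_e: each equals chi in its direction [a], so every formula is
   an instance of the same exchange identity. *)
have exch a X b f (XE : forall g, X g = chi a g) S
    (hS : [\/ S = OT, S = OA | S = TA]) :
    (vertical s p f -> vpart s L p v (cov_tensor nabla S p v a b f) =
       X (S p v b f) - S p v b (X f)) /\
    (ghorizontal s L p v f -> hpart s L p v (cov_tensor nabla S p v a b f) =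
       X (S p v b f) - S p v b (X f)).
  rewrite !XE.
  exact (cov_oneill_exchange hL hs hnd hn a b f erefl ap hv (S := S) hS).
have exT a X b f XE := exch a X b f XE _ (Or31 _ _ erefl).
have exA a X b f XE := exch a X b f XE _ (Or32 _ _ erefl).
have exTA a X b f XE := exch a X b f XE _ (Or33 _ _ erefl).
split; [|split; [|split]].
- split.
  + exact ((exA w _ e u TwE).1 hu).
  + exact ((exA x _ e u AxE).1 hu).
  + exact ((exT w _ e u TwE).1 hu).
  + exact ((exT x _ e u AxE).1 hu).
- move=> y hy; split.
  + exact ((exA w _ e y TwE).2 hy).
  + exact ((exA x _ e y AxE).2 hy).
  + exact ((exT w _ e y TwE).2 hy).
  + exact ((exT x _ e y AxE).2 hy).
- exact ((exTA e _ h u TAeE).1 hu).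
- by move=> y hy; have H := (exTA e _ h y TAeE).2 hy; exact H.
Qed.
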